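(* Let $R$ be a commutative Noetherian ring, let $k$ be a non-negative integer, and let $M$ be a finitely generated $R$-module such that $M^\ast=\operatorname{Hom}_R(M,R)$ has locally finite Gorenstein dimension on $\widetilde{X}^{k-1}(R)$, i.e. $\operatorname{G-dim}_{R_\mathfrak{p}}((M^\ast)_\mathfrak{p})<\infty$ for every $\mathfrak{p}\in\widetilde{X}^{k-1}(R)$. Then the following conditions are equivalent: (1) $M$ is $k$-torsionfree; (2) $M$ is a $k$-syzygy; (3) $M$ satisfies $(\widetilde{S}_k)$.
   Context: All modules are finitely generated. $\widetilde{X}^{j}(R)$ is the set of prime ideals $\mathfrak{p}$ of $R$ with $\operatorname{depth}_{R_\mathfrak{p}}(R_\mathfrak{p})\le j$ (so it is empty for $j=-1$). The Auslander transpose $\operatorname{Tr}(M)$ is the cokernel of $\varphi_1^\ast:P_0^\ast\to P_1^\ast$, where $P_1\xrightarrow{\varphi_1}P_0\to M\to 0$ is a presentation by (finitely generated) projective modules; it is unique up to projective summands. $M$ is $k$-torsionfree if $\operatorname{Ext}_R^i(\operatorname{Tr}(M),R)=0$ for all $1\le i\le k$. For $k\ge1$, $M$ is a $k$-syzygy if there is an exact sequence $0\to M\to P_{k-1}\to\cdots\to P_0$ with every $P_i$ projective; every module is a $0$-syzygy. $M$ satisfies $(\widetilde{S}_k)$ if $\operatorname{depth}_{R_\mathfrak{p}}(M_\mathfrak{p})\ge\min\{k,\operatorname{depth}_{R_\mathfrak{p}}(R_\mathfrak{p})\}$ for all primes $\mathfrak{p}$ of $R$ (usual convention: the zero module has depth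 $+\infty$). A module $G$ is totally reflexive if it is reflexive and $\operatorname{Ext}_R^i(G,R)=\operatorname{Ext}_R^i(G^\ast,R)=0$ for all $i>0$. $\operatorname{G-dim}_R(M)$ is the infimum of the non-negative integers $m$ for which there is an exact sequence $0\to G_m\to\cdots\to G_0\to M\to 0$ with every $G_i$ totally reflexive. *)

(* Defs.v *)
From HB Require Import structures.
From mathcomp Require Import all_boot all_order all_algebra.
From mathcomp Require Import generic_quotient.
From mathcomp Require Import ring.
From mathcomp Require Import boolp classical_sets constructive_ereal.

Set Implicit Arguments.
Unset Strict Implicit.
Unset Printing Implicit Defensive.

Import Order.TTheory GRing.Theory Num.Theory.
Local Open Scope ring_scope.
Local Open Scope classical_set_scope.
Local Open Scope quotient_scope.

(** * Rings and ideals

Rings are [comPzRingType]s, so that the zero ring is allowed; this is why the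
ideal predicates of [ring_quotient], which require [1 != 0], are not used. *)

Section Ideals.
Variable R : comPzRingType.

Definition ideal (I : set R) : Prop :=
  [/\ I 0, forall x y, I x -> I y -> I (x + y) & forall a x, I x -> I (a * x)].

Definition prime_ideal (p : set R) : Prop :=
  [/\ ideal p, ~ p 1 & forall x y, p (x * y) -> p x \/ p y].

Definition noetherian : Prop :=
  forall I : set R, ideal I -> exists (n : nat) (g : 'I_n -> R),
    I = [set x | exists c : 'I_n -> R, x = \sum_i c i * g i].

Record spec := Spec { spec_set :> R -> Prop; specP : prime_ideal spec_set }.

End Ideals.

Definition fg_module (R : pzRingType) (M : lmodType R) : Prop :=
  exists (n : nat) (g : 'I_n -> M),
    forall x, exists c : 'I_n -> R, x = \sum_i c i *: g i.

Definition zero_module (R : pzRingType) (M : lmodType R) : Prop :=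
  forall x : M, x = 0.

(** * The dual [Hom_R(M, R)] *)

Section Dual.
Variable R : comPzRingType.

Definition dual (M : lmodType R) : Type := {linear M -> R^o}.

Section DualModule.
Variable M : lmodType R.

HB.instance Definition _ := gen_eqMixin (dual M).
HB.instance Definition _ := gen_choiceMixin (dual M).

Definition dual_app (f : dual M) (x : M) : R^o :=
  (f : {linear M -> R^o}) x.

Lemma dualP (f g : dual M) : dual_app f =1 dual_app g -> f = g.
Proof.
move=> /funext; case: f g => [f cf] [g cg] E.
have {}E : f = g := E.
subst g; congr GRing.Linear.Pack.
case: cf cg => [[a] [b]] [[a'] [b']].
by rewrite (Prop_irrelevance a a') (Prop_irrelevance b b').
Qed.

Definition dual_zero : dual M := (\0 : {linear M -> R^o}).
Definition dual_opp (f : dual M) : dual M :=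
  (\- (f : {linear M -> R^o}) : {linear M -> R^o}).
Definition dual_add (f g : dual M) : dual M :=
  ((f : {linear M -> R^o}) \+ (g : {linear M -> R^o}) : {linear M -> R^o}).
Definition dual_scale (a : R) (f : dual M) : dual M :=
  (a \*: (f : {linear M -> R^o}) : {linear M -> R^o}).

Lemma dual_addA : associative dual_add.
Proof. by move=> f g h; apply: dualP => x; exact: addrA. Qed.
Lemma dual_addC : commutative dual_add.
Proof. by move=> f g; apply: dualP => x; exact: addrC. Qed.
Lemma dual_add0 : left_id dual_zero dual_add.
Proof. by move=> f; apply: dualP => x; exact: add0r. Qed.
Lemma dual_addN : left_inverse dual_zero dual_opp dual_add.
Proof. by move=> f; apply: dualP => x; exact: addNr. Qed.

HB.instance Definition _ :=
  GRing.isZmodule.Build (dual M) dual_addA dual_addC dual_add0 dual_addN.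

Lemma dual_scaleA a b (f : dual M) :
  dual_scale a (dual_scale b f) = dual_scale (a * b) f.
Proof. by apply: dualP => x; exact: scalerA. Qed.
Lemma dual_scale1 : left_id 1 dual_scale.
Proof. by move=> f; apply: dualP => x; exact: scale1r. Qed.
Lemma dual_scaleDr : right_distributive dual_scale +%R.
Proof. by move=> a f g; apply: dualP => x; exact: scalerDr. Qed.
Lemma dual_scaleDl (f : dual M) :
  {morph dual_scale^~ f : a b / a + b}.
Proof. by move=> a b; apply: dualP => x; exact: scalerDl. Qed.

HB.instance Definition _ := GRing.Zmodule_isLmodule.Build R (dual M)
  dual_scaleA dual_scale1 dual_scaleDr dual_scaleDl.

End DualModule.

Section DualMap.
Variables (M N : lmodType R) (f : {linear M -> N}).

Definition dual_map (phi : dual N) : dual M :=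
  ((phi : {linear N -> R^o}) \o f : {linear M -> R^o}).

Lemma dual_map_linear : linear dual_map.
Proof. by move=> a phi psi; apply: dualP. Qed.

HB.instance Definition _ :=
  GRing.isLinear.Build R (dual N) (dual M) _ dual_map dual_map_linear.

End DualMap.

Section Bidual.
Variables (M : lmodType R) (x : M).

Definition bidual_fun (phi : dual M) : R^o := dual_app phi x.

Lemma bidual_fun_linear : linear bidual_fun.
Proof. by []. Qed.

HB.instance Definition _ :=
  GRing.isLinear.Build R (dual M) R^o _ bidual_fun bidual_fun_linear.

Definition bidual : dual (dual M) := (bidual_fun : {linear dual M -> R^o}).

End Bidual.

Definition reflexive_module (M : lmodType R) : Prop := bijective (@bidual M).

End Dual.

(** * Localization at a prime *)

Section Localization.
Variables (R : comPzRingType) (p : spec R).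

Record den := Den { den_val : R; denP : ~ p den_val }.
HB.instance Definition _ := gen_eqMixin den.
HB.instance Definition _ := gen_choiceMixin den.

Lemma den1_subproof : ~ p 1.
Proof. by case: (specP p). Qed.
Definition den1 : den := Den den1_subproof.

Lemma denM_subproof (s t : den) : ~ p (den_val s * den_val t).
Proof. by case: (specP p) => _ _ pM /pM []; exact: denP. Qed.
Definition denM (s t : den) : den := Den (@denM_subproof s t).

Section LocModule.
Variable M : lmodType R.

Definition loc_equiv (x y : M * den) : bool :=
  `[< exists u : den, den_val u *: (den_val y.2 *: x.1)
                    = den_val u *: (den_val x.2 *: y.1) >].

Lemma loc_equiv_refl : reflexive loc_equiv.
Proof. by move=> x; apply/asboolP; exists den1. Qed.

Lemma loc_equiv_sym : symmetric loc_equiv.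
Proof. by move=> x y; apply/asboolP/asboolP => -[u E]; exists u. Qed.

Lemma loc_equiv_trans : transitive loc_equiv.
Proof.
move=> [n t] [m s] [q r] /asboolP [u /= E] /asboolP [v /= F].
apply/asboolP; exists (denM (denM u v) t) => /=.
have -> : den_val u * den_val v * den_val t *: (den_val r *: m) =
    (den_val v * den_val r) *: (den_val u *: (den_val t *: m)).
  by rewrite !scalerA; congr (_ *: _); ring.
rewrite E.
have -> : (den_val v * den_val r) *: (den_val u *: (den_val s *: n)) =
    (den_val u * den_val s) *: (den_val v *: (den_val r *: n)).
  by rewrite !scalerA; congr (_ *: _); ring.
by rewrite F !scalerA; congr (_ *: _); ring.
Qed.

Canonical loc_equivRel :=
  EquivRel loc_equiv loc_equiv_refl loc_equiv_sym loc_equiv_trans.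

Definition loc : Type := {eq_quot loc_equivRel}.
HB.instance Definition _ := Choice.on loc.

Definition frac (m : M) (s : den) : loc :=
  \pi_({eq_quot loc_equivRel}) (m, s).
Definition loc_num (x : loc) : M := (repr (x : {eq_quot loc_equivRel})).1.
Definition loc_den (x : loc) : den := (repr (x : {eq_quot loc_equivRel})).2.

Lemma eq_frac m s n t : frac m s = frac n t <->
  exists u : den, den_val u *: (den_val t *: m) = den_val u *: (den_val s *: n).
Proof.
split; first by move=> /eqP; rewrite eqmodE => /asboolP.
by move=> E; apply/eqP; rewrite eqmodE; apply/asboolP.
Qed.

Lemma loc_fracE (x : loc) : x = frac (loc_num x) (loc_den x).
Proof. by rewrite /frac -surjective_pairing reprK. Qed.

Lemma fracP (x : loc) : exists m s, x = frac m s.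
Proof. by exists (loc_num x), (loc_den x); exact: loc_fracE. Qed.

Lemma loc_repr (m : M) (s : den) (x := frac m s) : exists u : den,
  den_val u *: (den_val s *: loc_num x) =
  den_val u *: (den_val (loc_den x) *: m).
Proof. by apply/eq_frac; rewrite -loc_fracE. Qed.

Definition loc_zero : loc := frac 0 den1.
Definition loc_opp (x : loc) : loc := frac (- loc_num x) (loc_den x).
Definition loc_add (x y : loc) : loc :=
  frac (den_val (loc_den y) *: loc_num x + den_val (loc_den x) *: loc_num y)
       (denM (loc_den x) (loc_den y)).

Lemma loc_oppE m s : loc_opp (frac m s) = frac (- m) s.
Proof.
apply/eq_frac; have [u E] := loc_repr m s.
by exists u; rewrite !scalerN E.
Qed.

Lemma loc_addE m s n t : loc_add (frac m s) (frac n t) =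
  frac (den_val t *: m + den_val s *: n) (denM s t).
Proof.
apply/eq_frac; have [u] := loc_repr m s; have [v] := loc_repr n t.
set m' := loc_num _; set s' := loc_den _; set n' := loc_num _.
set t' := loc_den _.
move: m' s' n' t' => n' t' m' s' E F; exists (denM u v) => /=.
rewrite !scalerDr; congr (_ + _).
  transitivity ((den_val v * den_val t * den_val t') *:
    (den_val u *: (den_val s *: m'))).
    by rewrite !scalerA; congr (_ *: _); ring.
  by rewrite F !scalerA; congr (_ *: _); ring.
transitivity ((den_val u * den_val s * den_val s') *:
  (den_val v *: (den_val t *: n'))).
  by rewrite !scalerA; congr (_ *: _); ring.
by rewrite E !scalerA; congr (_ *: _); ring.
Qed.

Lemma loc_addA : associative loc_add.
Proof.
move=> x y z.
case: (fracP x) => m1 [s1 ->]; case: (fracP y) => m2 [s2 ->];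
case: (fracP z) => m3 [s3 ->]; rewrite !loc_addE.
apply/eq_frac; exists den1 => /=; congr (_ *: _).
rewrite !scalerDr !scalerA !addrA.
by congr (_ *: _ + _ *: _ + _ *: _); ring.
Qed.

Lemma loc_addC : commutative loc_add.
Proof.
move=> x y.
case: (fracP x) => m1 [s1 ->]; case: (fracP y) => m2 [s2 ->];
rewrite !loc_addE.
apply/eq_frac; exists den1 => /=; congr (_ *: _).
by rewrite addrC; congr (_ *: _); ring.
Qed.

Lemma loc_add0 : left_id loc_zero loc_add.
Proof.
move=> x.
case: (fracP x) => m1 [s1 ->]; rewrite loc_addE scaler0 add0r scale1r.
by apply/eq_frac; exists den1 => /=; rewrite mul1r.
Qed.

Lemma loc_addN : left_inverse loc_zero loc_opp loc_add.
Proof.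
move=> x.
case: (fracP x) => m1 [s1 ->]; rewrite loc_oppE loc_addE scalerN addNr.
by apply/eq_frac; exists den1 => /=; rewrite !scaler0.
Qed.

HB.instance Definition _ :=
  GRing.isZmodule.Build loc loc_addA loc_addC loc_add0 loc_addN.

Lemma frac_add m s n t : frac m s + frac n t =
  frac (den_val t *: m + den_val s *: n) (denM s t).
Proof. exact: loc_addE. Qed.

End LocModule.

Lemma regular_scale (a b : R) : a *: (b : R^o) = a * b.
Proof. by []. Qed.

Section LocScale.
Variable M : lmodType R.

Definition loc_scale (a : loc R^o) (x : loc M) : loc M :=
  frac ((loc_num a : R) *: loc_num x) (denM (loc_den a) (loc_den x)).

Lemma loc_scaleE (a : R) s (m : M) t :
  loc_scale (frac (a : R^o) s) (frac m t) = frac (a *: m) (denM s t).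
Proof.
apply/eq_frac; have [v F] := loc_repr m t.
have [u E] : exists u : den,
    den_val u * (den_val s * (loc_num (frac (a : R^o) s) : R)) =
    den_val u * (den_val (loc_den (frac (a : R^o) s)) * a) :> R.
  exact: (loc_repr (a : R^o) s).
move: (loc_num (frac (a : R^o) s)) (loc_den (frac (a : R^o) s)) E.
move: (loc_num _) (loc_den _) F.
move=> m' t' F a' s' E; exists (denM u v) => /=.
transitivity ((den_val u * (den_val s * a')) *:
  (den_val v *: (den_val t *: m'))).
  by rewrite !scalerA; congr (_ *: _); ring.
by rewrite E F !scalerA; congr (_ *: _); ring.
Qed.

Lemma loc_ringP (a : loc R^o) : exists (r : R) s, a = frac (r : R^o) s.
Proof. by have [r [s ->]] := fracP a; exists r, s. Qed.

Lemma loc_ring_add (a b : R) s t : frac (a : R^o) s + frac (b : R^o) t =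
  frac ((den_val t * a + den_val s * b : R) : R^o) (denM s t).
Proof. exact: frac_add. Qed.

Lemma loc_scaleDr a : {morph loc_scale a : x y / x + y}.
Proof.
move=> x y.
case: (fracP x) => m1 [s1 ->]; case: (fracP y) => m2 [s2 ->];
case: (loc_ringP a) => a1 [t1 ->].
rewrite !(frac_add, loc_scaleE).
apply/eq_frac; exists den1 => /=; congr (_ *: _).
by rewrite !scalerDr !scalerA; congr (_ *: _ + _ *: _); ring.
Qed.

Lemma loc_scaleDl x : {morph loc_scale^~ x : a b / a + b}.
Proof.
move=> a b.
case: (fracP x) => m1 [s1 ->].
case: (loc_ringP a) => a1 [t1 ->].
case: (loc_ringP b) => a2 [t2 ->].
rewrite loc_ring_add !loc_scaleE frac_add.
apply/eq_frac; exists den1 => /=; congr (_ *: _).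
rewrite !scalerDl !scalerDr !scalerA.
by congr (_ *: _ + _ *: _); ring.
Qed.

End LocScale.

(* R_p is the localization of R as a module over itself; the product of
   fractions is then the action of this R_p on itself. *)
Definition loc_ring : Type := loc R^o.
HB.instance Definition _ := GRing.Zmodule.on loc_ring.

Definition loc_one : loc_ring := frac (1 : R^o) den1.
Definition loc_mul (a b : loc_ring) : loc_ring := loc_scale a b.

Lemma loc_scaleA (M : lmodType R) (a b : loc_ring) (x : loc M) :
  loc_scale a (loc_scale b x) = loc_scale (loc_mul a b) x.
Proof.
case: (fracP x) => m [s ->]; case: (loc_ringP a) => r [t ->].
case: (loc_ringP b) => q [u ->]; rewrite /loc_mul.
have -> : loc_scale (frac (q : R^o) u) (frac m s) = frac (q *: m) (denM u s).
  exact: loc_scaleE.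
have -> : loc_scale (frac (r : R^o) t) (frac (q : R^o) u) =
    frac ((r * q : R) : R^o) (denM t u).
  exact: loc_scaleE.
rewrite !loc_scaleE; apply/eq_frac; exists den1 => /=; congr (_ *: _).
by rewrite !scalerA; congr (_ *: _); ring.
Qed.

Lemma loc_scale1 (M : lmodType R) (x : loc M) : loc_scale loc_one x = x.
Proof.
case: (fracP x) => m [s ->]; rewrite loc_scaleE scale1r.
by apply/eq_frac; exists den1 => /=; rewrite mul1r.
Qed.

Lemma loc_mulA : associative loc_mul.
Proof. by move=> a b c; exact: loc_scaleA. Qed.

Lemma loc_mulC : commutative loc_mul.
Proof.
move=> a b.
case: (loc_ringP a) => a1 [t1 ->].
case: (loc_ringP b) => a2 [t2 ->]; rewrite /loc_mul !loc_scaleE.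
apply/eq_frac; exists den1 => /=; congr (_ *: _).
by rewrite !regular_scale; ring.
Qed.

Lemma loc_mul1 : left_id loc_one loc_mul.
Proof. by move=> a; exact: loc_scale1. Qed.

Lemma loc_mulDl : left_distributive loc_mul +%R.
Proof. by move=> a b c; exact: loc_scaleDl. Qed.

HB.instance Definition _ := GRing.Zmodule_isComPzRing.Build loc_ring
  loc_mulA loc_mulC loc_mul1 loc_mulDl.

HB.instance Definition _ (M : lmodType R) :=
  GRing.Zmodule_isLmodule.Build loc_ring (loc M)
    (@loc_scaleA M) (@loc_scale1 M) (@loc_scaleDr M) (@loc_scaleDl M).

End Localization.

(** * Homological algebra *)

Section Homological.
Variable R : comPzRingType.
Implicit Types M N P T G : lmodType R.

Definition exact_at M N T (f : {linear M -> N}) (g : {linear N -> T}) : Prop :=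
  forall y, g y = 0 <-> exists x, f x = y.

Definition projective P : Prop :=
  forall M N (g : {linear M -> N}) (h : {linear P -> N}),
    (forall y, exists x, g x = y) ->
    exists f : {linear P -> M}, forall x, g (f x) = h x.

Definition fg_projective P : Prop := fg_module P /\ projective P.

(* ... -> C 2 -> C 1 -> C 0 -> M -> 0 is exact; a finite resolution is
   one padded with zero modules. *)
Definition resolution M (C : nat -> lmodType R)
    (d : forall i, {linear C i.+1 -> C i}) (e : {linear C 0%N -> M}) : Prop :=
  [/\ forall y, exists x, e x = y,
      exact_at (d 0%N) e
    & forall i, exact_at (d i.+1) (d i)].

(* The cohomology of Hom(C, N) vanishes in degree i. *)
Definition Hom_exact N (C : nat -> lmodType R)
    (d : forall i, {linear C i.+1 -> C i}) (i : nat) : Prop :=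
  match i with
  | 0 => forall f : {linear C 0%N -> N},
      (forall x, f (d 0%N x) = 0) -> forall x, f x = 0
  | i.+1 => forall f : {linear C i.+1 -> N},
      (forall x, f (d i.+1 x) = 0) ->
      exists g : {linear C i -> N}, forall x, f x = g (d i x)
  end.

(* Ext^i(M, N) = 0. Every module has a projective resolution, and the
   cohomology of Hom(C, N) does not depend on the choice of C. *)
Definition Ext_vanishes (i : nat) M N : Prop :=
  exists (C : nat -> lmodType R) (d : forall i, {linear C i.+1 -> C i})
         (e : {linear C 0%N -> M}),
    [/\ forall j, projective (C j), resolution d e & Hom_exact N d i].

(* T is a cokernel of the dual of phi : P1 -> P0, where P1 -> P0 -> M -> 0 is
   a projective presentation of M. *)
Definition transpose M T : Prop :=
  exists (P1 P0 : lmodType R) (phi : {linear P1 -> P0}) (e : {linear P0 -> M})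
         (q : {linear dual P1 -> T}),
    [/\ fg_projective P1 /\ fg_projective P0,
        (forall y, exists x, e x = y) /\ exact_at phi e
      & (forall y, exists x, q x = y) /\ exact_at (dual_map phi) q].

(* The transpose is unique up to projective summands, on which Ext vanishes in
   positive degrees, so the choice of T is immaterial. *)
Definition torsionfree (k : nat) M : Prop :=
  exists T, transpose M T /\
    forall i, (1 <= i <= k)%N -> Ext_vanishes i T R^o.

(* The syzygy sequence 0 -> M -> P_{k-1} -> ... -> P_0 is indexed in increasing
   order, Q j being P_{k-1-j}; the Q j with j >= k play no role. *)
Definition syzygy (k : nat) M : Prop :=
  k = 0%N \/
  exists (Q : nat -> lmodType R) (d : forall j, {linear Q j -> Q j.+1})
         (e : {linear M -> Q 0%N}),
    [/\ forall j, (j < k)%N -> fg_projective (Q j),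
        injective e,
        (1 < k)%N -> exact_at e (d 0%N)
      & forall j, (j.+2 < k)%N -> exact_at (d j) (d j.+1)].

Definition totally_reflexive G : Prop :=
  [/\ fg_module G, reflexive_module G,
      forall i, (0 < i)%N -> Ext_vanishes i G R^o
    & forall i, (0 < i)%N -> Ext_vanishes i (dual G) R^o].

Definition G_resolution_of_length (m : nat) M : Prop :=
  exists (C : nat -> lmodType R) (d : forall i, {linear C i.+1 -> C i})
         (e : {linear C 0%N -> M}),
    [/\ resolution d e,
        forall i, (i <= m)%N -> totally_reflexive (C i)
      & forall i, (m < i)%N -> zero_module (C i)].

Definition Gdim M : \bar int :=
  infimum +oo%E [set (m%:Z)%:E | m in [set m | G_resolution_of_length m M]].

End Homological.

(** * Depth over a local ring *)

Section Depth.
Variable A : comPzRingType.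

(* The maximal ideal when A is local. *)
Definition nonunits : set A := [set x | ~ exists y, y * x = 1].

Variable M : lmodType A.

(* m belongs to (x_0, ..., x_{i-1}) M *)
Definition in_partial_ideal n (x : 'I_n -> A) (i : nat) (m : M) : Prop :=
  exists c : 'I_n -> M, m = \sum_(j < n | (j < i)%N) x j *: c j.

Definition regular_sequence n (x : 'I_n -> A) : Prop :=
  [/\ forall i, nonunits (x i),
      forall (i : 'I_n) m,
        in_partial_ideal x i (x i *: m) -> in_partial_ideal x i m
    & exists m, ~ in_partial_ideal x n m].

Definition depth : \bar int :=
  if `[< zero_module M >] then +oo%E else
  supremum 0%E
    [set (n%:Z)%:E | n in [set n | exists x : 'I_n -> A, regular_sequence x]].

End Depth.

Definition Xtilde (R : comPzRingType) (j : int) : set (spec R) :=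
  [set p | (depth (loc_ring p)^o <= j%:E)%E].

Definition Stilde (R : comPzRingType) (k : nat) (M : lmodType R) : Prop :=
  forall p : spec R,
    (Order.min (k%:Z)%:E (depth (loc_ring p)^o) <= depth (loc p M))%E.

(* Main.v *)
From HB Require Import structures.
From Pilot Require Import Defs.
From mathcomp Require Import all_boot all_order all_algebra.
From mathcomp Require Import ring.
From mathcomp Require Import boolp classical_sets constructive_ereal.
(* Fractions are those of the localization, not of a fraction field. *)
Import Pilot.Defs.

Set Implicit Arguments.
Unset Strict Implicit.
Unset Printing Implicit Defensive.

Import Order.TTheory GRing.Theory Num.Theory.
Local Open Scope ring_scope.
Local Open Scope classical_set_scope.

(** Let [T] be a transpose of [M], with a projective resolution
[... -> L_2 -> L_1 -> L_0 -> T -> 0] whose map [L_1 -> L_0] is the dual of a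
presentation of [M].
Dualising the resolution gives back the presentation of [M], followed by a
complex

    M -> dual L_2 -> dual L_3 -> ...

whose homology consists of the modules [Ext^i(T, R)], [i >= 1]. So [M] is
[k]-torsionfree exactly when the first [k] maps of this complex form a syzygy
sequence, which is the implication from (1) to (2) ([ext_syz]). From (2) to
(3) one localises and counts depths along the sequence ([syz_ext]).

For the implication from (3) to (1), suppose that [Ext^i(T, R)] is the first
of these modules that does not vanish, with [i <= k]. It is contained in the
cokernel [D] of the preceding map; let [p] be one of its associated primes, so
that [D_p] has depth zero. If the depth of [R_p] were at least [i], then by
(3) so would be that of [M_p], and counting depths along the exact sequence
from [M_p] to [D_p] would make the depth of [D_p] positive. Hence [R_p] has
depth less than [i], the hypothesis on [dual M] applies to [p], and [T_p] has
finite Gorenstein dimension, because [dual M] is a second syzygy of [T]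
([transpose_Gdim_lt]). The Auslander--Bridger inequality [Gdim_lt_ext] then
says that [Ext^i(T_p, R_p)] is zero, contrary to the choice of [p]. This is
[ext_transpose_eq0]; the induction there runs over the pairs consisting of a
syzygy of [T] and the matching cokernel, each of which is a transpose of the
other ([transpose_step]), so that only [Ext^1] has to be localised
([ext1_local_global]).

The Auslander--Bridger inequality reduces to one fact about a short exact
sequence [K -> G -> N] with [K] and [G] totally reflexive over a local ring
[A] of depth [d]: if [N] has depth at least [d], then every functional on [K]
extends to [G]. Were it not so, a nonzero map from [dual K] to the residue
field [k] would vanish on the functionals that come from [G]. Composed with a
nonzero class in [Ext^d(k, A)] it yields, by the symmetry of bilinear maps, a nonzero class in
[Ext^d(k, K)] that dies in [Ext^d(k, G)], hence comes from [Ext^(d-1)(k, N)],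
which is zero ([restriction_onto1], [restriction_onto]; for [d = 0] already
the class in [Hom(k, K)] gives a contradiction, [restriction_onto0]).

Depth enters through the vanishing of [Ext^l(k, M)] ([depth_geP]). No Ext
group is ever formed: the argument needs only to know when it is zero, or when
a map induces zero on it, and this is expressed through extending maps from
one syzygy at a time ([Ext_map0]). The long exact sequences then become short
diagram chases. *)

(** * Submodules, quotients and short exact sequences *)

Section LinearMaps.
Variables (R : pzRingType) (M N : lmodType R).

Definition lin_fun (f : M -> N) (_ : linear f) : M -> N := f.

HB.instance Definition _ (f : M -> N) (h : linear f) :=
  GRing.isLinear.Build R M N *:%R (lin_fun h) h.

Definition Lin (f : M -> N) (h : linear f) : {linear M -> N} := lin_fun h.

End LinearMaps.

Definition submodule (R : pzRingType) (M : lmodType R) (S : set M) : Prop :=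
  S 0 /\ forall a x y, S x -> S y -> S (a *: x + y).

Section Submodules.
Variables (R : comPzRingType) (M : lmodType R) (S : set M).
Hypothesis subS : submodule S.

Let S0 : S 0. Proof. by case: subS. Qed.
Let SD x y : S x -> S y -> S (x + y).
Proof. by move=> Sx Sy; rewrite -(scale1r x); case: subS => _; exact. Qed.
Let SZ a x : S x -> S (a *: x).
Proof. by move=> Sx; rewrite -(addr0 (a *: x)); case: subS => ? ; exact. Qed.
Let SN x : S x -> S (- x).
Proof. by rewrite -scaleN1r; exact: SZ. Qed.

Record submod := Submod { submod_val : M; submodP : S submod_val }.
HB.instance Definition _ := gen_eqMixin submod.
HB.instance Definition _ := gen_choiceMixin submod.

Lemma submod_inj : injective submod_val.
Proof.
by move=> [x Sx] [y Sy] /= E; subst y; congr Submod; exact: Prop_irrelevance.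
Qed.

Definition submod_add x y := Submod (SD (submodP x) (submodP y)).
Definition submod_opp x := Submod (SN (submodP x)).
Definition submod_scale a x := Submod (SZ a (submodP x)).

Fact submod_addA : associative submod_add.
Proof. by move=> x y z; apply: submod_inj; exact: addrA. Qed.
Fact submod_addC : commutative submod_add.
Proof. by move=> x y; apply: submod_inj; exact: addrC. Qed.
Fact submod_add0 : left_id (Submod S0) submod_add.
Proof. by move=> x; apply: submod_inj; exact: add0r. Qed.
Fact submod_addN : left_inverse (Submod S0) submod_opp submod_add.
Proof. by move=> x; apply: submod_inj; exact: addNr. Qed.
HB.instance Definition _ :=
  GRing.isZmodule.Build submod submod_addA submod_addC submod_add0 submod_addN.

Fact submod_scaleA a b x :
  submod_scale a (submod_scale b x) = submod_scale (a * b) x.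
Proof. by apply: submod_inj; exact: scalerA. Qed.
Fact submod_scale1 : left_id 1 submod_scale.
Proof. by move=> x; apply: submod_inj; exact: scale1r. Qed.
Fact submod_scaleDr : right_distributive submod_scale +%R.
Proof. by move=> a x y; apply: submod_inj; exact: scalerDr. Qed.
Fact submod_scaleDl x : {morph submod_scale^~ x : a b / a + b}.
Proof. by move=> a b; apply: submod_inj; exact: scalerDl. Qed.
HB.instance Definition _ := GRing.Zmodule_isLmodule.Build R submod
  submod_scaleA submod_scale1 submod_scaleDr submod_scaleDl.

Fact submod_val_linear : linear submod_val. Proof. by []. Qed.

Lemma submodule_incl : exists (K : lmodType R) (j : {linear K -> M}),
  injective j /\ forall x, S x <-> exists y, j y = x.
Proof.
exists submod, (Lin submod_val_linear); split; first exact: submod_inj.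
by move=> x; split=> [Sx|[[y Sy] <-]] //; exists (Submod Sx).
Qed.

(** A quotient element is stored as the representative of its coset picked by the
    choice operator. *)
Definition coset_repr (x : M) : M := xget 0 [set y | S (y - x)].

Let reprP x : S (coset_repr x - x).
Proof.
rewrite /coset_repr; case: xgetP => [y -> //|/(_ x)] /=.
by rewrite subrr => /(_ S0).
Qed.

Let repr_eq x y : S (x - y) -> coset_repr x = coset_repr y.
Proof.
move=> Sxy; rewrite /coset_repr; congr xget; apply/seteqP; split=> z /= Sz.
  by rewrite -(subrK x z) -addrA; exact: SD.
by rewrite -(subrK y z) -addrA; apply: SD => //; rewrite -opprB; exact: SN.
Qed.

Let repr_sub x : coset_repr (coset_repr x) = coset_repr x.
Proof. exact/repr_eq/reprP. Qed.

Record quomod := Quomod { quo_val : M; quo_valP : coset_repr quo_val = quo_val }.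
HB.instance Definition _ := gen_eqMixin quomod.
HB.instance Definition _ := gen_choiceMixin quomod.

Let quo_inj : injective quo_val.
Proof.
by move=> [x Sx] [y Sy] /= E; subst y; congr Quomod; exact: Prop_irrelevance.
Qed.

Definition quo_pi (x : M) : quomod := Quomod (repr_sub x).

Let quo_pi_eq x y : quo_pi x = quo_pi y <-> S (x - y).
Proof.
split=> [/(congr1 quo_val) /= E|Sxy]; last first.
  by apply: quo_inj; exact: repr_eq.
rewrite -(subrK (coset_repr x) x) -addrA; apply: SD.
  by rewrite -opprB; exact/SN/reprP.
by rewrite E; exact: reprP.
Qed.

Let quo_val_pi x : S (quo_val (quo_pi x) - x). Proof. exact: reprP. Qed.

Let quo_pi_val x : quo_pi (quo_val x) = x.
Proof. by apply: quo_inj => /=; exact: quo_valP. Qed.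

Definition quo_add x y := quo_pi (quo_val x + quo_val y).
Definition quo_opp x := quo_pi (- quo_val x).
Definition quo_scale a x := quo_pi (a *: quo_val x).

Let quo_addE x y : quo_add (quo_pi x) (quo_pi y) = quo_pi (x + y).
Proof.
apply/quo_pi_eq; rewrite opprD addrACA.
by apply: SD; exact: quo_val_pi.
Qed.
Let quo_oppE x : quo_opp (quo_pi x) = quo_pi (- x).
Proof. by apply/quo_pi_eq; rewrite -opprD; exact/SN/quo_val_pi. Qed.
Let quo_scaleE a x : quo_scale a (quo_pi x) = quo_pi (a *: x).
Proof. by apply/quo_pi_eq; rewrite -scalerBr; exact/SZ/quo_val_pi. Qed.

Fact quo_addA : associative quo_add.
Proof.
move=> x y z; rewrite -(quo_pi_val x) -(quo_pi_val y) -(quo_pi_val z).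
by rewrite !quo_addE addrA.
Qed.
Fact quo_addC : commutative quo_add.
Proof.
by move=> x y; rewrite -(quo_pi_val x) -(quo_pi_val y) !quo_addE addrC.
Qed.
Fact quo_add0 : left_id (quo_pi 0) quo_add.
Proof. by move=> x; rewrite -(quo_pi_val x) !quo_addE add0r. Qed.
Fact quo_addN : left_inverse (quo_pi 0) quo_opp quo_add.
Proof. by move=> x; rewrite -(quo_pi_val x) quo_oppE !quo_addE addNr. Qed.
HB.instance Definition _ :=
  GRing.isZmodule.Build quomod quo_addA quo_addC quo_add0 quo_addN.

Let quo_piD x y : quo_pi x + quo_pi y = quo_pi (x + y).
Proof. exact: quo_addE. Qed.

Fact quo_scaleA a b x : quo_scale a (quo_scale b x) = quo_scale (a * b) x.
Proof. by rewrite -(quo_pi_val x) !quo_scaleE scalerA. Qed.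
Fact quo_scale1 : left_id 1 quo_scale.
Proof. by move=> x; rewrite -(quo_pi_val x) !quo_scaleE scale1r. Qed.
Fact quo_scaleDr : right_distributive quo_scale +%R.
Proof.
move=> a x y; rewrite -(quo_pi_val x) -(quo_pi_val y) quo_piD !quo_scaleE.
by rewrite quo_piD scalerDr.
Qed.
Fact quo_scaleDl x : {morph quo_scale^~ x : a b / a + b}.
Proof.
by move=> a b; rewrite -(quo_pi_val x) !quo_scaleE quo_piD scalerDl.
Qed.
HB.instance Definition _ := GRing.Zmodule_isLmodule.Build R quomod
  quo_scaleA quo_scale1 quo_scaleDr quo_scaleDl.

Fact quo_pi_linear : linear quo_pi.
Proof. by move=> a x y; rewrite -quo_piD -[quo_pi (_ *: _)]quo_scaleE. Qed.

Lemma submodule_quot : exists (Q : lmodType R) (q : {linear M -> Q}),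
  (forall y, exists x, q x = y) /\ forall x, q x = 0 <-> S x.
Proof.
exists quomod, (Lin quo_pi_linear); split=> [y|x].
  by exists (quo_val y); exact: quo_pi_val.
by rewrite -[X in S X]subr0; exact: quo_pi_eq.
Qed.

End Submodules.

Section ShortExact.
Variable R : comPzRingType.
Implicit Types (M N K P Q B : lmodType R).

Definition surj M N (f : {linear M -> N}) : Prop := forall y, exists x, f x = y.

Definition ses K P N (j : {linear K -> P}) (e : {linear P -> N}) : Prop :=
  [/\ injective j, surj e & exact_at j e].

Lemma inj_linear M N (f : {linear M -> N}) :
  (forall x, f x = 0 -> x = 0) -> injective f.
Proof.
by move=> f0 x y E; apply/eqP; rewrite -subr_eq0; apply/eqP/f0; rewrite linearB E subrr.
Qed.

Lemma ses0 K P N (j : {linear K -> P}) (e : {linear P -> N}) x :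
  ses j e -> e (j x) = 0.
Proof. by case=> _ _ ex; apply/ex; exists x. Qed.

Lemma submodule_ker M N (e : {linear M -> N}) : submodule [set x | e x = 0].
Proof.
split=> [|a x y /= Ex Ey] /=; first exact: linear0.
by rewrite linearP Ex Ey scaler0 addr0.
Qed.

Lemma submodule_img M N (e : {linear M -> N}) :
  submodule [set y | exists x, e x = y].
Proof.
split=> [|a _ _ [x <-] [y <-]] /=; first by exists 0; exact: linear0.
by exists (a *: x + y); rewrite linearP.
Qed.

Lemma ses_ker M N (e : {linear M -> N}) : surj e ->
  exists (K : lmodType R) (j : {linear K -> M}), ses j e.
Proof.
move=> se; have [K [j [ij Ej]]] := submodule_incl (submodule_ker e).
by exists K, j; split=> // y; exact: Ej.
Qed.

Lemma ses_coker M N (j : {linear M -> N}) : injective j ->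
  exists (Q : lmodType R) (q : {linear N -> Q}), ses j q.
Proof.
move=> ij; have [Q [q [sq Eq]]] := submodule_quot (submodule_img j).
by exists Q, q; split=> // y; exact: Eq.
Qed.

(** Prescribing a linear map by a relation avoids choosing preimages each time a
    map is factored through a surjection. *)
Lemma linear_of_rel M N (r : M -> N -> Prop) :
    (forall x, exists y, r x y) ->
    (forall a x1 y1 x2 y2, r x1 y1 -> r x2 y2 -> r (a *: x1 + x2) (a *: y1 + y2)) ->
    (forall y, r 0 y -> y = 0) ->
  exists f : {linear M -> N}, forall x y, r x y <-> f x = y.
Proof.
move=> tot lin fun0.
have uniq x y z : r x y -> r x z -> y = z.
  move=> ry rz; apply/eqP; rewrite -subr_eq0 addrC -scaleN1r; apply/eqP/fun0.
  by rewrite -(addNr x) -scaleN1r; exact: lin.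
have /choice [f rf] := tot.
have fl : linear f by move=> a x y; apply: uniq (rf _) _; exact: lin.
exists (Lin fl) => x y; split=> [rxy|<-]; last exact: rf.
exact: uniq (rf x) rxy.
Qed.

Lemma factor_surj M N B (q : {linear M -> N}) (f : {linear M -> B}) :
  surj q -> (forall x, q x = 0 -> f x = 0) ->
  exists g : {linear N -> B}, forall x, g (q x) = f x.
Proof.
move=> sq kf.
have [||_ [x [qx <-]]|g Eg] :=
    @linear_of_rel N B (fun y z => exists x, q x = y /\ f x = z).
- by move=> y; have [x <-] := sq y; exists (f x), x.
- move=> a _ _ _ _ [x [<- <-]] [y [<- <-]].
  by exists (a *: x + y); rewrite !linearP.
- exact: kf.
by exists g => x; apply/Eg; exists x.
Qed.

Lemma factor_inj K P N (j : {linear K -> P}) (f : {linear N -> P}) :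
  injective j -> (forall x, exists y, j y = f x) ->
  exists g : {linear N -> K}, forall x, j (g x) = f x.
Proof.
move=> ij fj.
have [|||g Eg] := @linear_of_rel N K (fun x y => j y = f x).
- exact: fj.
- by move=> a x1 y1 x2 y2 E1 E2; rewrite !linearP E1 E2.
- by move=> y; rewrite linear0 -(linear0 j); exact: ij.
by exists g => x; apply/Eg.
Qed.

Lemma factor_ker K P N B (j : {linear K -> P}) (e : {linear P -> B})
    (f : {linear N -> P}) : ses j e -> (forall x, e (f x) = 0) ->
  exists g : {linear N -> K}, forall x, j (g x) = f x.
Proof. by case=> ij _ ex f0; apply: factor_inj => // x; exact/ex. Qed.

Lemma factor_coker K P N B (j : {linear K -> P}) (e : {linear P -> N})
    (f : {linear P -> B}) : ses j e -> (forall x, f (j x) = 0) ->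
  exists g : {linear N -> B}, forall x, g (e x) = f x.
Proof. by case=> _ se ex f0; apply: factor_surj => // x /ex [y <-]. Qed.

Lemma ses_image M N (f : {linear M -> N}) :
  exists (I : lmodType R) (q : {linear M -> I}) (j : {linear I -> N}),
    [/\ surj q, injective j & forall x, j (q x) = f x].
Proof.
have [I [j [ij Ej]]] := submodule_incl (submodule_img f).
have [|q Eq] := @factor_inj _ _ _ j f ij; first by move=> x; apply/Ej; exists x.
exists I, q, j; split=> // y; have [x Ex] : exists x, f x = j y.
  by apply/Ej; exists y.
by exists x; apply: ij; rewrite Eq.
Qed.

Lemma exact_image M N Q (f : {linear M -> N}) (e : {linear N -> Q}) :
    surj e -> exact_at f e ->
  exists (I : lmodType R) (p : {linear M -> I}) (i : {linear I -> N}),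
    [/\ ses i e, surj p & forall x, i (p x) = f x].
Proof.
move=> se ex; have [I [p [i [sp ii Ei]]]] := ses_image f.
exists I, p, i; split=> //; split=> // y; rewrite ex.
split=> [[x <-]|[x <-]]; first by exists (p x).
by have [x' <-] := sp x; exists x'.
Qed.

Lemma exact_corestrict M N P Q (f : {linear M -> N}) (g : {linear N -> Q})
    (p : {linear N -> P}) (i : {linear P -> Q}) :
  injective i -> (forall x, i (p x) = g x) -> exact_at f g -> exact_at f p.
Proof.
move=> ii E ex y; rewrite -ex -E; split=> [->|iy]; first exact: linear0.
by apply: ii; rewrite iy linear0.
Qed.

Lemma prod_lin_subproof M N P (f : {linear M -> P}) (g : {linear N -> P}) :
  linear (fun x : (M * N)%type => f x.1 + g x.2).
Proof.
by move=> a [x1 x2] [y1 y2] /=; rewrite !linearP scalerDr addrACA.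
Qed.
Definition copair M N P (f : {linear M -> P}) (g : {linear N -> P}) :
  {linear (M * N)%type -> P} := Lin (prod_lin_subproof f g).

Lemma pair_lin_subproof M N P (f : {linear P -> M}) (g : {linear P -> N}) :
  linear (fun x : P => (f x, g x)).
Proof. by move=> a x y; rewrite !linearP. Qed.
Definition pair_lin M N P (f : {linear P -> M}) (g : {linear P -> N}) :
  {linear P -> (M * N)%type} := Lin (pair_lin_subproof f g).

Lemma pullback M N B (f : {linear M -> B}) (g : {linear N -> B}) :
  exists (Z : lmodType R) (p : {linear Z -> M}) (q : {linear Z -> N}),
    [/\ forall z, f (p z) = g (q z),
        forall z w, p z = p w -> q z = q w -> z = w,
        forall P (u : {linear P -> M}) (v : {linear P -> N}),
          (forall x, f (u x) = g (v x)) ->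
          exists w : {linear P -> Z}, forall x, p (w x) = u x /\ q (w x) = v x
      & forall x y, f x = g y -> exists z, p z = x /\ q z = y].
Proof.
have [Z [j [ij Ej]]] := submodule_incl
  (submodule_ker (copair f (\- g : {linear N -> B}))).
exists Z, (fst \o j : {linear _ -> _}), (snd \o j : {linear _ -> _}); split=> /=.
- move=> z; apply/eqP; rewrite -subr_eq0; apply/eqP.
  by have /(Ej _).2 := ex_intro (fun y => j y = j z) z erefl.
- by move=> z w E1 E2; apply: ij; move: (j z) (j w) E1 E2 => [? ?] [? ?] /= -> ->.
2: {
  move=> x y E; have [|z Ez] := (Ej (x, y)).1; last by exists z; rewrite Ez.
  by rewrite /= /lin_fun /= E subrr.
}
move=> P u v E.
have [x|w Ew] := @factor_inj _ _ _ j (pair_lin u v) ij.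
  by apply/Ej; rewrite /= /lin_fun /= E subrr.
by exists w => x; rewrite Ew.
Qed.

End ShortExact.


(** * Finitely generated modules over a noetherian ring *)

Section FreeModules.
Variable R : comPzRingType.
Implicit Types (M N K P Q : lmodType R).

Lemma comb_linear M n (g : 'I_n -> M) :
  linear (fun c : 'rV[R]_n => \sum_i c 0 i *: g i).
Proof.
move=> a c d; rewrite scaler_sumr -big_split; apply: eq_bigr => i _.
by rewrite !mxE scalerDl scalerA.
Qed.

Definition comb M n (g : 'I_n -> M) : {linear 'rV[R]_n -> M} :=
  Lin (comb_linear g).

Lemma comb_delta M n (g : 'I_n -> M) i : comb g (delta_mx 0 i) = g i.
Proof.
rewrite /= /lin_fun (bigD1 i) //= big1 ?addr0 => [|j ji].
  by rewrite mxE !eqxx scale1r.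
by rewrite mxE (negbTE ji) andbF scale0r.
Qed.

Lemma eq_rV M n (f g : {linear 'rV[R]_n -> M}) :
  (forall i, f (delta_mx 0 i) = g (delta_mx 0 i)) -> forall x, f x = g x.
Proof.
move=> E x; rewrite (row_sum_delta x) !linear_sum.
by apply: eq_bigr => i _; rewrite !linearZ E.
Qed.

Lemma fgP M : fg_module M <-> exists n (f : {linear 'rV[R]_n -> M}), surj f.
Proof.
split=> [[n [g genM]]|[n [f sf]]].
  exists n, (comb g) => y; have [c ->] := genM y.
  exists (\row_i c i); rewrite /= /lin_fun.
  by apply: eq_bigr => i _; rewrite mxE.
exists n, (fun i => f (delta_mx 0 i)) => y; have [x <-] := sf y.
exists (x 0); rewrite {1}(row_sum_delta x) linear_sum.
by apply: eq_bigr => i _; rewrite linearZ.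
Qed.

Lemma fg_surj M N (f : {linear M -> N}) : surj f -> fg_module M -> fg_module N.
Proof.
move=> sf /fgP [n [g sg]]; apply/fgP; exists n, (f \o g : {linear _ -> _}) => y.
by have [x <-] := sf y; have [z <-] := sg x; exists z.
Qed.

Lemma fg_rV n : fg_module 'rV[R]_n.
Proof. by apply/fgP; exists n, (idfun : {linear _ -> _}) => x; exists x. Qed.

Lemma projective_rV n : projective 'rV[R]_n.
Proof.
move=> M N g h sg; have /choice [b Eb] := fun i => sg (h (delta_mx 0 i)).
exists (comb b) => x.
apply: (@eq_rV _ _ (g \o comb b : {linear _ -> _})) => i.
by rewrite -Eb -[in RHS](comb_delta b).
Qed.


Lemma fg_projective_rV n : fg_projective 'rV[R]_n.
Proof. by split; [exact: fg_rV|exact: projective_rV]. Qed.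

Lemma projective_lift P M N (g : {linear M -> N}) (h : {linear P -> N}) :
  projective P -> surj g -> exists f : {linear P -> M}, forall x, g (f x) = h x.
Proof. by move=> pP; exact: pP. Qed.

Lemma projective_retract P Q (r : {linear Q -> P}) (s : {linear P -> Q}) :
  (forall x, r (s x) = x) -> projective Q -> projective P.
Proof.
move=> rs pQ M N g h sg.
have [f Ef] := projective_lift (h \o r : {linear _ -> _}) pQ sg.
by exists (f \o s : {linear _ -> _}) => x; rewrite /= Ef /= rs.
Qed.

(** Retracts of finite free modules are the workable form of finitely
    generated projective modules: they pass through duals and localizations. *)
Lemma fg_projectiveP P : fg_projective P <->
  exists n (r : {linear 'rV[R]_n -> P}) (s : {linear P -> 'rV[R]_n}),
    forall x, r (s x) = x.
Proof.
split=> [[/fgP [n [r sr]] pP]|[n [r [s rs]]]].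
  have [s Es] := projective_lift (idfun : {linear P -> P}) pP sr.
  by exists n, r, s.
split; last exact: projective_retract rs (@projective_rV n).
by apply: fg_surj (fg_rV n) => x; exists (s x); exact: rs.
Qed.

Lemma projective_prod P Q : projective P -> projective Q -> projective (P * Q)%type.
Proof.
move=> pP pQ M N g h sg.
have inl_lin : linear (fun x : P => (x, 0 : Q)).
  by move=> a x y; congr pair; rewrite /= scaler0 addr0.
have inr_lin : linear (fun x : Q => (0 : P, x)).
  by move=> a x y; congr pair; rewrite /= scaler0 addr0.
have [u Eu] := projective_lift (h \o Lin inl_lin : {linear _ -> _}) pP sg.
have [v Ev] := projective_lift (h \o Lin inr_lin : {linear _ -> _}) pQ sg.
exists (copair u v) => -[x y]; rewrite /= /lin_fun linearD Eu Ev /= /lin_fun.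
by rewrite -linearD /= addrC; congr (h (_, _)); rewrite ?addr0 ?add0r.
Qed.

Lemma zero_fg M : zero_module M -> fg_module M.
Proof.
move=> zM; exists 0%N, (fun _ => 0) => x; exists (fun _ => 0).
by rewrite big_ord0 (zM x).
Qed.

Lemma fg_ext K M N (j : {linear K -> M}) (e : {linear M -> N}) :
  ses j e -> fg_module K -> fg_module N -> fg_module M.
Proof.
move=> [ij se ex] /fgP [m [f sf]] /fgP [n [g sg]].
have [h Eh] := projective_lift g (@projective_rV n) se.
pose jf : {linear _ -> _} := j \o f.
apply: (@fg_surj ('rV[R]_m * 'rV[R]_n)%type _ (copair jf h)).
  move=> x; have [d Ed] := sg (e x).
  have /ex [y Ey] : e (x - h d) = 0 by rewrite linearB Eh Ed subrr.
  have [c Ec] := sf y; exists (c, d).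
  by rewrite /= /lin_fun /= Ec Ey subrK.
apply/fgP; exists (m + n)%N.
have spl : linear (fun v : 'rV[R]_(m + n) => (lsubmx v, rsubmx v)).
  by move=> a x y; congr pair; rewrite linearP.
exists (Lin spl) => -[x y]; exists (row_mx x y).
by rewrite /= /lin_fun row_mxKl row_mxKr.
Qed.

End FreeModules.

Section Noetherian.
Variable R : comPzRingType.
Implicit Types (M N K P Q : lmodType R).
Hypothesis noethR : noetherian R.

Lemma noetherian_ideal K (j : {linear K -> R^o}) : injective j -> fg_module K.
Proof.
move=> ij.
have idI : ideal [set x : R | exists y, j y = x].
  split=> /=; first by exists 0; exact: linear0.
    by move=> _ _ [x <-] [y <-]; exists (x + y); exact: linearD.
  by move=> a _ [x <-]; exists (a *: x); exact: linearZ.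
have [n [g Eg]] := noethR idI.
have gI i : exists y, j y = g i.
  suff : [set x : R | exists y, j y = x] (g i) by [].
  rewrite Eg /=; exists (fun k => (k == i)%:R).
  rewrite (bigD1 i) //= big1 ?addr0 => [|k /negbTE ->]; rewrite ?mul0r //.
  by rewrite eqxx mul1r.
have /choice [h Eh] := gI; exists n, h => x.
have [c Ec] : [set x : R | exists c, x = \sum_i c i * g i] (j x).
  by rewrite -Eg; exists x.
exists c; apply: ij; rewrite Ec linear_sum; apply: eq_bigr => i _.
by rewrite linearZ Eh.
Qed.

(** Induction on the rank: the first coordinates form an ideal, the kernel of
    the first coordinate lives in one rank less. *)
Lemma fg_sub_rV n K (j : {linear K -> 'rV[R]_n}) : injective j -> fg_module K.
Proof.
elim: n K j => [|n IHn] K j ij.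
  by apply: zero_fg => x; apply: ij; exact/rowP/(fun i => match notF (ltn_ord i) with end).
have cl : linear (fun x : K => j x 0 ord0 : R^o).
  by move=> a x y; rewrite linearP !mxE.
have [I [q [i [sq ii Eq]]]] := ses_image (Lin cl).
have [K' [j' sj']] := ses_ker sq.
apply: (fg_ext sj' _ (noetherian_ideal ii)).
have rl : linear (fun x : K' => \row_k (j (j' x) 0 (lift ord0 k)) : 'rV[R]_n).
  by move=> a x y; apply/rowP => k; rewrite !linearP !mxE.
apply: (IHn K' (Lin rl)); apply: inj_linear => x /rowP E.
case: (sj') => ij' _ _; apply: ij'; apply: ij; rewrite linear0 linear0.
apply/rowP => k; rewrite mxE; have [m ->|->] := unliftP ord0 k.
  by have := E m; rewrite !mxE.
have /= := Eq (j' x); rewrite (ses0 x sj') linear0 /lin_fun => E0.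
by rewrite -E0.
Qed.

Lemma fg_sub K M (j : {linear K -> M}) : injective j -> fg_module M -> fg_module K.
Proof.
move=> ij /fgP [n [f sf]].
have [Z [p [q [E uniq univ elt]]]] := pullback f j.
have sq : surj q.
  move=> y; have [x Ex] := sf (j y).
  by have [z [_ Ez]] := elt _ _ Ex; exists z.
apply: fg_surj sq _; apply: (@fg_sub_rV n _ p); apply: inj_linear => z pz.
apply: uniq; rewrite !linear0 //; apply: ij.
by rewrite -E pz !linear0.
Qed.

Lemma ses_fg K M N (j : {linear K -> M}) (e : {linear M -> N}) :
  ses j e -> fg_module M -> fg_module K /\ fg_module N.
Proof. by case=> ij se _ fgM; split; [exact: fg_sub ij fgM|exact: fg_surj se fgM]. Qed.

Lemma fg_cover N : fg_module N ->
  exists (K P : lmodType R) (j : {linear K -> P}) (e : {linear P -> N}),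
    [/\ fg_module K, fg_projective P & ses j e].
Proof.
move=> /fgP [n [e se]]; have [K [j sj]] := ses_ker se.
exists K, 'rV[R]_n, j, e; split=> //; last exact: fg_projective_rV.
by case: (ses_fg sj (fg_rV R n)).
Qed.

Lemma submodule_fg M (S : set M) : fg_module M -> submodule S ->
  exists n (g : 'I_n -> M), (forall i, S (g i)) /\
    forall T : set M, submodule T -> (forall i, T (g i)) -> S `<=` T.
Proof.
move=> fgM subS; have [K [j [ij Ej]]] := submodule_incl subS.
have [n [g Eg]] := fg_sub ij fgM.
exists n, (fun i => j (g i)); split=> [i|T [T0 TD] Tg x /Ej [y <-]].
  by apply/Ej; exists (g i).
have [c ->] := Eg y; rewrite linear_sum.
elim/big_ind: _ => // [u v Tu Tv|i _]; first by rewrite -(scale1r u); exact: TD.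
by rewrite linearZ /= -[_ *: _]addr0; exact: TD.
Qed.

(** The ascending chain condition in the form used below. A family without
    maximal element would contain a strictly increasing sequence, whose union
    is finitely generated. *)
Lemma noetherian_max M (F : set (set M)) : fg_module M ->
    (forall S, F S -> submodule S) -> (exists S, F S) ->
  exists2 S, F S & forall T, F T -> S `<=` T -> T `<=` S.
Proof.
move=> fgM subF [S0 FS0].
apply: contrapT => nomax.
have next (S : {S | F S}) : exists T : {S | F S},
    sval S `<=` sval T /\ ~ sval T `<=` sval S.
  apply: contrapT => no; apply: nomax; exists (sval S); first exact: svalP.
  move=> T FT ST; apply: contrapT => TS; apply: no.
  by exists (exist _ T FT).
have /choice [f Ef] := next.
pose c n := sval (iter n f (exist _ S0 FS0)).
have Fc n : F (c n) by exact: svalP.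
have cS m n : (m <= n)%N -> c m `<=` c n.
  elim: n => [|n IHn]; first by rewrite leqn0 => /eqP ->.
  rewrite leq_eqVlt => /predU1P [-> //|]; rewrite ltnS => /IHn mn.
  exact: subset_trans mn (Ef _).1.
have subU : submodule [set x | exists n, c n x].
  split=> [|a x y [m cx] [n cy]]; first by exists 0%N; case: (subF _ (Fc 0%N)).
  exists (maxn m n); case: (subF _ (Fc (maxn m n))) => _; apply.
    by apply: cS cx; exact: leq_maxl.
  by apply: cS cy; exact: leq_maxr.
have [n [g [Ug genU]]] := submodule_fg fgM subU.
have /choice [h Eh] := Ug.
pose N := (\max_i h i)%N.
have := genU (c N) (subF _ (Fc N)).
have gN i : c N (g i) by apply: cS (Eh i); exact: leq_bigmax.
move=> /(_ gN) UN; apply: ((Ef (iter N f (exist _ S0 FS0))).2) => x cx.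
by apply: UN; exists N.+1.
Qed.

End Noetherian.


(** * Vanishing of Ext, one syzygy at a time *)

Section Ext.
Variable R : comPzRingType.
Implicit Types (M N K P Q B C X Y Z : lmodType R).

(** Extending [b o f] from [K] to [P], for every [f]: when [K] is the syzygy of
    a projective presentation [P -> N], this says that [b] induces zero on
    [Ext^1(N, _)]. *)
Definition extends K P B B' (b : {linear B -> B'}) (j : {linear K -> P}) : Prop :=
  forall f : {linear K -> B}, exists g : {linear P -> B'},
    forall x, g (j x) = b (f x).

(** [b] induces the zero map from [Ext^i(N, B)] to [Ext^i(N, B')]. For [i > 0]
    this is stated on [Ext^1] of an iterated syzygy of [N]. The presentations
    are existentially quantified; [ext1_extends] and [ext_shift] show that any
    others will do. *)
Fixpoint Ext_map0 (i : nat) N B B' (b : {linear B -> B'}) : Prop :=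
  match i with
  | 0 => forall (f : {linear N -> B}) x, b (f x) = 0
  | i'.+1 => exists (K P : lmodType R) (j : {linear K -> P}) (e : {linear P -> N}),
      [/\ projective P, ses j e
        & match i' with 0 => extends b j | _ => Ext_map0 i' K b end]
  end.

Definition ext_id B : {linear B -> B} := idfun.

Definition Ext_eq0 i N B : Prop := Ext_map0 i N (ext_id B).

Lemma surj_id N : surj (ext_id N). Proof. by move=> x; exists x. Qed.

Lemma lift_ses P K Y N (i : {linear K -> Y}) (p : {linear Y -> N})
    (e : {linear P -> N}) : projective P -> ses i p ->
  exists h : {linear P -> Y}, forall x, p (h x) = e x.
Proof. by move=> pP [_ sp _]; exact: projective_lift pP sp. Qed.

(** [Ext^1] may be tested on every extension [X -> Y -> N], projective or not:
    [Y] is a quotient of [X * P], and the prescribed maps on [X] and [P] agree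
    on the kernel. *)
Lemma ext1_extends N B B' (b : {linear B -> B'}) X Y
    (i : {linear X -> Y}) (p : {linear Y -> N}) :
  Ext_map0 1 N b -> ses i p -> extends b i.
Proof.
move=> [K [P [j [e [pP sje ext]]]]] sip f.
have [h Eh] := lift_ses e pP sip.
have [|h0 Eh0] := factor_ker (f := h \o j : {linear _ -> _}) sip.
  by move=> x; rewrite /= Eh (ses0 x sje).
have [g Eg] := ext (f \o h0 : {linear _ -> _}).
have [||G EG] := factor_surj (q := copair i h)
    (f := copair (b \o f : {linear _ -> _}) g).
- move=> y; case: (sje) => _ se _; case: (sip) => _ _ ex.
  have [z Ez] := se (p y).
  have [|x Ex] := (ex (y - h z)).1; first by rewrite linearB Eh Ez subrr.
  by exists (x, z); rewrite /= /lin_fun /= Ex subrK.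
- move=> [x z]; rewrite /= /lin_fun /= => E.
  have ez : e z = 0.
    by have := congr1 p E; rewrite linear0 linearD (ses0 _ sip) add0r Eh.
  case: (sje) => _ _ ex; have [k Ek] := (ex z).1 ez; subst z.
  case: (sip) => ii _ _.
  rewrite Eg /= -[h (j k)]/((h \o j) k) -Eh0 -linearD /= in E *.
  have /(congr1 (fun z => b (f z))) := ii _ _ (etrans E (esym (linear0 i))).
  by rewrite !linearD !linear0.
exists G => x; have := EG (x, 0); rewrite /= /lin_fun /= !linear0 !addr0.
by move=> ->.
Qed.

(** ** Independence of the chosen presentations *)

(** [N'] is a retract of [N] up to maps that factor through a projective
    module. Positive Ext does not see such maps, and syzygies inherit the
    relation, whatever presentations they come from; this replaces the
    comparison of projective resolutions. *)
Definition stable_retract N' N : Prop :=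
  exists (s : {linear N' -> N}) (r : {linear N -> N'})
         (Q : lmodType R) (u : {linear N' -> Q}) (v : {linear Q -> N'}),
    projective Q /\ forall x, x = r (s x) + v (u x).

Lemma retract_stable N' N (s : {linear N' -> N}) (r : {linear N -> N'}) :
  (forall x, r (s x) = x) -> stable_retract N' N.
Proof.
move=> rs; exists s, r, 'rV[R]_0, (\0 : {linear _ -> _}), (\0 : {linear _ -> _}).
by split=> [|x]; [exact: projective_rV|rewrite /= addr0].
Qed.

Lemma stable_retract_refl N : stable_retract N N.
Proof. exact: (@retract_stable N N (ext_id N) (ext_id N)). Qed.

Lemma stable_retract_syzygy N N' K P K' P'
    (j : {linear K -> P}) (e : {linear P -> N})
    (j' : {linear K' -> P'}) (e' : {linear P' -> N'}) :
    projective P -> projective P' -> ses j e -> ses j' e' ->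
    stable_retract N' N ->
  exists (a : {linear P' -> P}) (s : {linear K' -> K}) (r : {linear K -> K'})
         (w : {linear P' -> K'}),
    (forall x, j (s x) = a (j' x)) /\ forall x, x = r (s x) + w (j' x).
Proof.
move=> pP pP' sje sje' [s [r [Q [u [v [pQ E]]]]]].
have [a Ea] := lift_ses (s \o e' : {linear _ -> _}) pP' sje.
have [b Eb] := lift_ses (r \o e : {linear _ -> _}) pP sje'.
have [v' Ev'] := lift_ses v pQ sje'.
have [|s0 Es0] := factor_ker (f := a \o j' : {linear _ -> _}) sje.
  by move=> x; rewrite /= Ea /= (ses0 x sje') linear0.
have [|r0 Er0] := factor_ker (f := b \o j : {linear _ -> _}) sje'.
  by move=> x; rewrite /= Eb /= (ses0 x sje) linear0.
pose d : {linear P' -> P'} :=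
  (ext_id P' \- ((b \o a) \+ (v' \o (u \o e')))).
have [|w Ew] := factor_ker (f := d) sje'.
  by move=> x; rewrite /d /= linearB linearD Eb /= Ea /= Ev' -E subrr.
exists a, s0, r0, w; split=> // x; case: (sje') => ij' _ _.
apply: ij'; rewrite linearD Er0 Ew /d /= Es0 /= (ses0 x sje') !linear0 addr0.
by rewrite addrC subrK.
Qed.

Section Noeth.
Hypothesis noethR : noetherian R.

Lemma ext_stable i N N' B B' (b : {linear B -> B'}) : fg_module N' ->
  stable_retract N' N -> Ext_map0 i.+1 N b -> Ext_map0 i.+1 N' b.
Proof.
elim: i N N' => [|i IHi] N N' fgN' st [K [P [j [e [pP sje ext]]]]];
  have [K' [P' [j' [e' [fgK' [_ pP'] sje']]]]] := fg_cover noethR fgN';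
  have [a [s [r [w [Es Er]]]]] := stable_retract_syzygy pP pP' sje sje' st;
  exists K', P', j', e'; split=> //.
  move=> f; have [g Eg] := ext (f \o r : {linear _ -> _}).
  exists ((g \o a) \+ (b \o (f \o w)) : {linear _ -> _}) => x /=.
  by rewrite -Es Eg /= -!linearD -Er.
by apply: IHi ext => //; exists s, r, P', j', w.
Qed.

(** Dimension shifting along any projective presentation, not only along the
    one hidden in the hypothesis. *)
Lemma ext_shift i N K P (j : {linear K -> P}) (e : {linear P -> N})
    B B' (b : {linear B -> B'}) : projective P -> fg_module K -> ses j e ->
  Ext_map0 i.+2 N b <-> Ext_map0 i.+1 K b.
Proof.
move=> pP fgK sje; split=> [[K1 [P1 [j1 [e1 [pP1 sje1 ext]]]]]|]; last first.
  by exists K, P, j, e.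
apply: ext_stable ext => //.
have [a [s [r [w [Es Er]]]]] :=
  stable_retract_syzygy pP1 pP sje1 sje (stable_retract_refl N).
by exists s, r, P, j, w.
Qed.

Lemma ext1_shift N K P (j : {linear K -> P}) (e : {linear P -> N})
    B B' (b : {linear B -> B'}) : projective P -> ses j e ->
  Ext_map0 1 N b <-> extends b j.
Proof.
by move=> pP sje; split=> [/ext1_extends ext|]; [exact: ext sje|exists K, P, j, e].
Qed.

End Noeth.

(** ** Exact sequences in the first variable *)

Lemma horseshoe N' C N K' P' K P (a : {linear N' -> C}) (c : {linear C -> N})
    (j' : {linear K' -> P'}) (e' : {linear P' -> N'})
    (j : {linear K -> P}) (e : {linear P -> N}) :
    ses a c -> ses j' e' -> ses j e -> projective P ->
  exists (K2 : lmodType R) (J : {linear K2 -> (P' * P)%type})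
      (E : {linear (P' * P)%type -> C}) (i : {linear K' -> K2}) (p : {linear K2 -> K}),
    [/\ ses J E, ses i p, forall x, J (i x) = (j' x, 0)
      & forall z, j (p z) = (J z).2].
Proof.
move=> sac sje' sje pP; have [h Eh] := lift_ses e pP sac.
pose E := copair (a \o e' : {linear _ -> _}) h.
have cE z : c (E z) = e z.2.
  by rewrite /= /lin_fun /= linearD (ses0 _ sac) Eh add0r.
case: (sac) => ia sc exa; case: (sje) => ij se ex; case: (sje') => ij' se' ex'.
have sE : surj E.
  move=> y; have [p Ep] := se (c y).
  have [|n En] := (exa (y - h p)).1; first by rewrite linearB Eh Ep subrr.
  have [p' Ep'] := se' n; exists (p', p).
  by rewrite /= /lin_fun /= Ep' En subrK.
have [K2 [J sJE]] := ses_ker sE; case: (sJE) => iJ _ exJ.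
have [|p Ep] := factor_ker (f := snd \o J : {linear _ -> _}) sje.
  by move=> z; rewrite /= -cE (ses0 _ sJE) linear0.
have linl : linear (fun x : K' => (j' x, 0 : P)).
  by move=> u x y; congr pair; rewrite /= ?linearP ?scaler0 ?addr0.
have [|i Ei] := factor_ker (f := Lin linl) sJE.
  by move=> x; rewrite /= /lin_fun /= (ses0 _ sje') !linear0 addr0.
exists K2, J, E, i, p; split=> //; split.
- apply: inj_linear => x ix; apply: ij'; have := Ei x.
  by rewrite ix linear0 linear0 => -[].
- move=> k; have [|n En] := (exa (h (j k))).1; first by rewrite Eh (ses0 _ sje).
  have [p' Ep'] := se' n.
  have [|z Ez] := (exJ (- p', j k)).1.
    by rewrite /= /lin_fun /= !linearN Ep' En addNr.
  by exists z; apply: ij; rewrite Ep /= Ez.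
- move=> z; split=> [pz|[x <-]]; last by apply: ij; rewrite Ep /= Ei linear0.
  have J2 : (J z).2 = 0 by rewrite -[LHS](Ep z) pz linear0.
  have := ses0 z sJE; rewrite /= /lin_fun /= J2 linear0 addr0 => aJ.
  have [|x Ex] := (ex' (J z).1).1; first by apply: ia; rewrite aJ linear0.
  by exists x; apply: iJ; rewrite Ei /= /lin_fun Ex -J2; case: (J z).
Qed.

(** Exactness of [Ext(N, B) -> Ext(C, B) -> Ext(N', B)]. *)
Lemma ext_middle i N' C N B (a : {linear N' -> C}) (c : {linear C -> N}) :
  ses a c -> Ext_eq0 i.+1 N' B -> Ext_eq0 i.+1 N B -> Ext_eq0 i.+1 C B.
Proof.
elim: i N' C N a c => [|i IHi] N' C N a c sac
  [K' [P' [j' [e' [pP' sje' ext']]]]] [K [P [j [e [pP sje ext]]]]];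
  have [K2 [J [E [u [p [sJE sip Ei Ep]]]]]] := horseshoe sac sje' sje pP;
  exists K2, (P' * P)%type, J, E; split=> //; try exact: projective_prod;
  last exact: IHi sip _ _.
move=> f; have [g' Eg'] := ext' (f \o u : {linear _ -> _}).
have [|f1 Ef1] := factor_coker (f := f \- (g' \o (fst \o J)) : {linear _ -> _}) sip.
  by move=> x; rewrite /= Ei Eg' subrr.
have [g Eg] := ext f1; exists (copair g' g) => x.
by rewrite /= /lin_fun -Ep Eg Ef1 /= addrC subrK.
Qed.

(** Pulling a projective presentation of [N] back along [C -> N] turns the
    sequence [N' -> C -> N] into [K -> Z -> C], where [Z] is the sum of [N'] and
    [P]. Thus the exactness at the other two places of the long exact sequence
    follows from exactness in the middle. *)
Lemma ses_rotate N' C N K P (a : {linear N' -> C}) (c : {linear C -> N})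
    (j : {linear K -> P}) (e : {linear P -> N}) :
    ses a c -> ses j e -> projective P ->
  exists (Z : lmodType R) (i : {linear K -> Z}) (q : {linear Z -> C})
      (s : {linear N' -> Z}) (p : {linear Z -> P})
      (r : {linear Z -> N'}) (v : {linear P -> Z}),
    [/\ ses i q, ses s p, forall k, p (i k) = j k,
        forall x, r (s x) = x & forall z, z = s (r z) + v (p z)]
    /\ forall x, q (s x) = a x.
Proof.
move=> sac sje pP; case: (sac) => ia sc exa; case: (sje) => ij se ex.
have [h Eh] := lift_ses e pP sac.
have [Z [p [q [E uniq univ elt]]]] := pullback e c.
have [|i Ei] := univ _ j (\0 : {linear _ -> _}).
  by move=> x; rewrite /= linear0 (ses0 _ sje).
have [|s Es] := univ _ (\0 : {linear _ -> _}) a.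
  by move=> x; rewrite /= linear0 (ses0 _ sac).
have [|v Ev] := univ _ (ext_id P) h; first by move=> x; rewrite /= Eh.
have [|r Er] := factor_ker (f := q \- (h \o p) : {linear _ -> _}) sac.
  by move=> z; rewrite /= linearB Eh E subrr.
exists Z, i, q, s, p, r, v; split; last by move=> x; rewrite (Es x).2.
split.
- split.
  + apply: inj_linear => x ix; apply: ij; rewrite linear0 -(Ei x).1 ix.
    exact: linear0.
  + move=> y; have [x Ex] := se (c y).
    by have [z [_ Ez]] := elt _ _ Ex; exists z.
  + move=> z; split=> [qz|[x <-]]; last by rewrite (Ei x).2.
    have [|x Ex] := (ex (p z)).1; first by rewrite E qz linear0.
    by exists x; apply: uniq; rewrite ?(Ei x).1 ?(Ei x).2 ?Ex.
- split.
  + apply: inj_linear => x sx; apply: ia; rewrite linear0 -(Es x).2 sx.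
    exact: linear0.
  + by move=> y; exists (v y); rewrite (Ev y).1.
  + move=> z; split=> [pz|[x <-]]; last by rewrite (Es x).1.
    have [|x Ex] := (exa (q z)).1; first by rewrite -E pz linear0.
    by exists x; apply: uniq; rewrite ?(Es x).1 ?(Es x).2 ?Ex.
- by move=> k; rewrite (Ei k).1.
- by move=> x; apply: ia; rewrite Er /= (Es x).1 (Es x).2 linear0 subr0.
- move=> z; apply: uniq; first by rewrite linearD (Es _).1 (Ev _).1 add0r.
  by rewrite linearD (Es _).2 (Ev _).2 Er /= subrK.
Qed.

Section FirstVariable.
Hypothesis noethR : noetherian R.

Lemma ext_left i N' C N B (a : {linear N' -> C}) (c : {linear C -> N}) :
  ses a c -> fg_module C -> Ext_eq0 i.+1 C B -> Ext_eq0 i.+2 N B -> Ext_eq0 i.+1 N' B.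
Proof.
move=> sac fgC extC [K [P [j [e [pP sje extK]]]]].
have [Z [ii [q [s [p [r [v [[siq _ _ rs _] _]]]]]]]] := ses_rotate sac sje pP.
apply: (ext_stable noethR (ses_fg noethR sac fgC).1 (retract_stable rs)).
exact: ext_middle siq extK extC.
Qed.

Lemma ext_right i N' C N B (a : {linear N' -> C}) (c : {linear C -> N}) :
  ses a c -> fg_module C -> Ext_eq0 i.+1 N' B -> Ext_eq0 i.+2 C B -> Ext_eq0 i.+2 N B.
Proof.
move=> sac fgC extN' extC.
have [K [P [j [e [fgK [_ pP] sje]]]]] := fg_cover noethR (ses_fg noethR sac fgC).2.
have [Z [ii [q [s [p [r [v [[siq _ _ _ E] _]]]]]]]] := ses_rotate sac sje pP.
have fgZ := fg_ext siq fgK fgC.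
apply/(ext_shift noethR _ _ pP fgK sje)/(ext_left siq fgZ) => //.
by apply: ext_stable extN' => //; exists r, s, P, p, v.
Qed.

(** The degree one case of [ext_right], where the vanishing of the connecting
    map is the hypothesis that maps extend from [N'] to [C]. *)
Lemma ext1_right N' C N B (a : {linear N' -> C}) (c : {linear C -> N}) :
  ses a c -> fg_module C -> extends (ext_id B) a -> Ext_eq0 1 C B -> Ext_eq0 1 N B.
Proof.
move=> sac fgC exta ext1C.
have [K [P [j [e [fgK [_ pP] sje]]]]] := fg_cover noethR (ses_fg noethR sac fgC).2.
have [Z [ii [q [s [p [r [v [[siq ssp pi _ _] qs]]]]]]]] := ses_rotate sac sje pP.
exists K, P, j, e; split=> // f.
have [g Eg] := ext1_extends ext1C siq f.
have [h Eh] := exta (g \o s : {linear _ -> _}).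
have [|G EG] := factor_coker (f := g \- (h \o q) : {linear _ -> _}) ssp.
  by move=> x; rewrite /= qs Eh /= subrr.
by exists G => k; rewrite -pi EG /= Eg (ses0 _ siq) linear0 subr0.
Qed.

End FirstVariable.
End Ext.


(** ** Exact sequences in the second variable *)

Section SecondVariable.
Variable R : comPzRingType.
Hypothesis noethR : noetherian R.
Variables (B' B B'' : lmodType R) (b : {linear B' -> B}) (c : {linear B -> B''}).
Hypothesis sbc : ses b c.
Implicit Types (N K P : lmodType R).

(** The connecting map to [Ext^1(N, B')] being zero, maps to [B''] lift to [B]. *)
Lemma ext1_lift N K P (j : {linear K -> P}) (e : {linear P -> N}) :
    projective P -> ses j e -> extends (ext_id B') j ->
  forall f : {linear N -> B''}, exists g : {linear N -> B}, forall x, c (g x) = f x.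
Proof.
move=> pP sje ext f.
have [g Eg] := lift_ses (f \o e : {linear _ -> _}) pP sbc.
have [|h Eh] := factor_ker (f := g \o j : {linear _ -> _}) sbc.
  by move=> x; rewrite /= Eg /= (ses0 _ sje) linear0.
have [h' Eh'] := ext h.
have [|G EG] := factor_coker (f := g \- (b \o h') : {linear _ -> _}) sje.
  by move=> x; rewrite /= Eh' /= Eh subrr.
exists G => y; case: (sje) => _ se _; have [x <-] := se y.
by rewrite EG /= linearB (ses0 _ sbc) subr0 Eg.
Qed.

Lemma ext_coker i N : fg_module N ->
  Ext_eq0 i N B -> Ext_eq0 i.+1 N B' -> Ext_eq0 i N B''.
Proof.
elim: i N => [|i IHi] N fgN extB extB';
  have [K [P [j [e [fgK [_ pP] sje]]]]] := fg_cover noethR fgN.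
  move/(ext1_shift _ pP sje) in extB'.
  move=> f x; have [g Eg] := ext1_lift pP sje extB' f.
  by rewrite /= -Eg [g x]extB linear0.
move/(ext_shift noethR _ _ pP fgK sje) in extB'.
case: i => [|i] in IHi extB extB' *; last first.
  move/(ext_shift noethR _ _ pP fgK sje) in extB.
  by apply/(ext_shift noethR _ _ pP fgK sje); exact: IHi.
move/(ext1_shift _ pP sje) in extB; apply/(ext1_shift _ pP sje) => f.
have [K2 [P2 [j2 [e2 [_ [_ pP2] sje2]]]]] := fg_cover noethR fgK.
move/(ext1_shift _ pP2 sje2) in extB'.
have [g Eg] := ext1_lift pP2 sje2 extB' f; have [h Eh] := extB g.
by exists (c \o h : {linear _ -> _}) => x; rewrite /= Eh /= Eg.
Qed.

(** The part of [ext_ker] common to degree one, where every map [N -> B''] is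
    zero, and to degree two, where [N] is replaced by its syzygy. *)
Lemma ext_ker_aux N K P (j : {linear K -> P}) (e : {linear P -> N}) :
    ses j e -> extends b j ->
    (forall f : {linear N -> B''}, exists g : {linear N -> B},
      forall x, c (g x) = f x) ->
  extends (ext_id B') j.
Proof.
move=> sje ext lift f; have [g Eg] := ext f.
have [|G EG] := factor_coker (f := c \o g : {linear _ -> _}) sje.
  by move=> x; rewrite /= Eg (ses0 _ sbc).
have [G' EG'] := lift G.
have [|h Eh] := factor_ker (f := g \- (G' \o e) : {linear _ -> _}) sbc.
  by move=> x; rewrite /= linearB EG' EG subrr.
exists h => x; case: (sbc) => ib _ _; apply: ib.
by rewrite Eh /= Eg (ses0 _ sje) linear0 subr0.
Qed.

(** Exactness of [Ext^i(N, B'') -> Ext^(i+1)(N, B') -> Ext^(i+1)(N, B)]. Only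
    the vanishing of the last map is assumed, so that multiplication by a
    regular element that kills [N] is covered. *)
Lemma ext_ker i N : fg_module N ->
  Ext_map0 i.+1 N b -> Ext_eq0 i N B'' -> Ext_eq0 i.+1 N B'.
Proof.
elim: i N => [|i IHi] N fgN extB extB'';
  have [K [P [j [e [fgK [_ pP] sje]]]]] := fg_cover noethR fgN.
  apply/(ext1_shift _ pP sje); move/(ext1_shift _ pP sje) in extB.
  apply: (ext_ker_aux sje extB) => f; exists (\0 : {linear _ -> _}) => x.
  by rewrite /= linear0 [f x]extB''.
apply/(ext_shift noethR _ _ pP fgK sje).
move/(ext_shift noethR _ _ pP fgK sje) in extB.
case: i => [|i] in IHi extB extB'' *; last first.
  by apply: IHi => //; move/(ext_shift noethR _ _ pP fgK sje) in extB''.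
move/(ext1_shift _ pP sje) in extB''.
have [K2 [P2 [j2 [e2 [_ [_ pP2] sje2]]]]] := fg_cover noethR fgK.
apply/(ext1_shift _ pP2 sje2); move/(ext1_shift _ pP2 sje2) in extB.
apply: (ext_ker_aux sje2 extB) => f.
have [g Eg] := extB'' f; have [h Eh] := lift_ses g pP sbc.
by exists (h \o j : {linear _ -> _}) => x; rewrite /= Eh Eg.
Qed.

End SecondVariable.

Section ExtMore.
Variable R : comPzRingType.
Implicit Types (A M N K P Q B C X Y Z : lmodType R).

Lemma Ext_eq0_map0 i N B B' (b : {linear B -> B'}) : Ext_eq0 i N B' -> Ext_map0 i N b.
Proof.
elim: i N => [|i IHi] N /=.
  by move=> ext f x; rewrite [b _](ext (b \o f : {linear _ -> _}) x).
move=> [K [P [j [e [pP sje ext]]]]]; exists K, P, j, e; split=> //.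
case: i => [|i] in IHi ext *; last exact: IHi.
by move=> f; have [g Eg] := ext (b \o f : {linear _ -> _}); exists g.
Qed.

(** [B] is a retract of a finite power of [A]. *)
Definition dominated B A : Prop :=
  exists n (f : 'I_n -> {linear B -> A}) (g : 'I_n -> {linear A -> B}),
    forall x, x = \sum_i g i (f i x).

Lemma sum_linear M N n (f : 'I_n -> {linear M -> N}) :
  linear (fun x => \sum_i f i x).
Proof.
move=> a x y; rewrite scaler_sumr -big_split; apply: eq_bigr => i _.
exact: linearP.
Qed.

Lemma ext_dominated i N A B : dominated B A -> Ext_eq0 i N A -> Ext_eq0 i N B.
Proof.
move=> [n [f [g E]]]; elim: i N => [|i IHi] N.
  move=> ext h x; rewrite /= (E (h x)) big1 // => k _.
  by rewrite [f k (h x)](ext (f k \o h : {linear _ -> _}) x) linear0.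
move=> [K [P [j [e [pP sje ext]]]]]; exists K, P, j, e; split=> //.
case: i => [|i] in IHi ext *; last exact: IHi.
move=> h; have /choice [H EH] := fun k => ext (f k \o h : {linear _ -> _}).
exists (Lin (sum_linear (fun k => g k \o H k : {linear _ -> _}))) => x.
rewrite /= /lin_fun [in RHS](E (h x)); apply: eq_bigr => k _ /=.
by rewrite EH.
Qed.

Lemma retract_dominated A B (s : {linear B -> A}) (r : {linear A -> B}) :
  (forall x, r (s x) = x) -> dominated B A.
Proof.
move=> rs; exists 1%N, (fun=> s), (fun=> r) => x.
by rewrite big_ord1 rs.
Qed.

Lemma fg_projective_dominated P : fg_projective P -> dominated P R^o.
Proof.
move=> /fg_projectiveP [n [r [s rs]]].
have cl k : linear (fun x : P => s x 0 k : R^o).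
  by move=> a x y; rewrite linearP !mxE.
have sl k : linear (fun a : R^o => (a : R) *: r (delta_mx 0 k)).
  by move=> a x y; rewrite scalerDl scalerA.
exists n, (fun k => Lin (cl k)), (fun k => Lin (sl k)) => x.
rewrite -[in LHS](rs x) {1}(row_sum_delta (s x)) linear_sum.
by apply: eq_bigr => k _; rewrite linearZ.
Qed.

Lemma zero_projective Z : zero_module Z -> projective Z.
Proof.
move=> z0 M N g h _; exists (\0 : {linear _ -> _}) => x.
by rewrite (z0 x) !linear0.
Qed.

Lemma zero_rV0 : zero_module 'rV[R]_0.
Proof. by move=> x; apply/rowP => -[]. Qed.

Lemma ses_zero_l N : ses (\0 : {linear 'rV[R]_0 -> N}) (ext_id N).
Proof.
split; [|exact: surj_id|] => [x y _|y]; first by rewrite (zero_rV0 x) (zero_rV0 y).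
by split=> [y0|[x <-]] //; exists 0; rewrite [RHS]y0.
Qed.

Lemma ext_zero i Z B : zero_module Z -> Ext_eq0 i Z B.
Proof.
elim: i Z => [|i IHi] Z z0; first by move=> f x /=; rewrite (z0 x) linear0.
exists 'rV[R]_0, Z, (\0 : {linear _ -> _}), (ext_id Z); split.
- exact: zero_projective.
- exact: ses_zero_l.
case: i IHi => [|i] IHi; last exact/IHi/zero_rV0.
move=> f; exists (\0 : {linear _ -> _}) => x.
by rewrite (zero_rV0 x) /= linear0.
Qed.

Lemma ext_projective i P B : projective P -> Ext_eq0 i.+1 P B.
Proof.
move=> pP; exists 'rV[R]_0, P, (\0 : {linear _ -> _}), (ext_id P); split=> //.
  exact: ses_zero_l.
case: i => [|i]; last exact: (@ext_zero i.+1 _ B zero_rV0).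
move=> f; exists (\0 : {linear _ -> _}) => x.
by rewrite (zero_rV0 x) /= linear0.
Qed.

(** Multiplication by [x] on [N] factors through a projective module. Unlike
    [x N = 0], this passes to syzygies, and it suffices for [x] to kill the
    positive Ext modules of [N]. *)
Definition stably_kills (x : R) N : Prop :=
  exists (Q : lmodType R) (u : {linear N -> Q}) (v : {linear Q -> N}),
    projective Q /\ forall y, v (u y) = x *: y.

Lemma stably_kills_syzygy x N K P (j : {linear K -> P}) (e : {linear P -> N}) :
  projective P -> ses j e -> stably_kills x N ->
  exists w : {linear P -> K}, forall y, w (j y) = x *: y.
Proof.
move=> pP sje [Q [u [v [pQ E]]]].
have [v' Ev'] := lift_ses v pQ sje.
have [|w Ew] := factor_ker
    (f := (x \*: ext_id P) \- (v' \o (u \o e)) : {linear _ -> _}) sje.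
  by move=> y; rewrite /= linearB linearZ Ev' E subrr.
exists w => y; case: (sje) => ij _ _; apply: ij.
by rewrite Ew /= linearZ (ses0 _ sje) !linear0 addr0.
Qed.

Lemma annihilated_stably_kills x N :
  (forall y : N, x *: y = 0) -> stably_kills x N.
Proof.
move=> xN; exists 'rV[R]_0, (\0 : {linear _ -> _}), (\0 : {linear _ -> _}).
by split=> [|y]; [exact: projective_rV|rewrite xN].
Qed.

Section Noeth.
Hypothesis noethR : noetherian R.

Lemma ext_zero_r i N Z : fg_module N -> zero_module Z -> Ext_eq0 i N Z.
Proof.
elim: i N => [|i IHi] N fgN z0; first by move=> f x; exact: z0.
have [K [P [j [e [fgK [_ pP] sje]]]]] := fg_cover noethR fgN.
exists K, P, j, e; split=> //; case: i IHi => [|i] IHi; last exact: IHi.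
by move=> f; exists (\0 : {linear _ -> _}) => x; rewrite /= (z0 (f x)).
Qed.

Lemma stably_kills_ext i x N B : fg_module N -> stably_kills x N ->
  Ext_map0 i.+1 N (x \*: ext_id B).
Proof.
elim: i N => [|i IHi] N fgN kN;
  have [K [P [j [e [fgK [_ pP] sje]]]]] := fg_cover noethR fgN;
  have [w Ew] := stably_kills_syzygy pP sje kN; exists K, P, j, e; split=> //.
  move=> f; exists (f \o w : {linear _ -> _}) => y.
  by rewrite /= Ew linearZ.
by apply: IHi => //; exists P, j, w.
Qed.

End Noeth.

(** A projective resolution provides a presentation of each syzygy. *)
Lemma Ext_vanishes_eq0 i N B : Ext_vanishes i N B -> Ext_eq0 i N B.
Proof.
move=> [C [d [e [pC]]]]; elim: i N C d e pC => [|i IHi] N C d e pC [se ex0 ex] ext.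
  move=> f x; have [y <-] := se x.
  apply: (ext (f \o e : {linear _ -> _})) => z /=.
  by rewrite (ex0 (d 0%N z)).2 ?linear0 //; exists z.
have [K [j sje]] := ses_ker se.
have [|q Eq] := factor_ker (f := d 0%N) sje.
  by move=> x; apply/ex0; exists x.
have sq : surj q.
  case: (sje) => ij _ _ y; have [x Ex] := (ex0 (j y)).1 (ses0 y sje).
  by exists x; apply: ij; rewrite Eq.
have exq : exact_at (d 1%N) q.
  move=> y; rewrite -ex; split=> [qy|dy]; first by rewrite -Eq qy linear0.
  by case: (sje) => ij _ _; apply: ij; rewrite Eq dy linear0.
exists K, (C 0%N), j, e; split=> //.
case: i IHi ext => [|i] IHi ext; last first.
  exact: (IHi K (fun i => C i.+1) (fun i => d i.+1) q).
move=> f; have [|g Eg] := ext (f \o q : {linear _ -> _}).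
  by move=> x; rewrite /= (exq _).2 ?linear0 //; exists x.
by exists g => y; have [x <-] := sq y; rewrite Eq -Eg.
Qed.

Section FreeResolution.
Hypothesis noethR : noetherian R.

Record presentation (N : lmodType R) := Presentation {
  pr_syz : lmodType R; pr_rank : nat;
  pr_incl : {linear pr_syz -> 'rV[R]_pr_rank};
  pr_proj : {linear 'rV[R]_pr_rank -> N};
  pr_fg : fg_module pr_syz;
  pr_ses : ses pr_incl pr_proj }.

Lemma presentationP N : fg_module N -> exists _ : presentation N, True.
Proof.
move=> /fgP [n [e se]]; have [K [j sj]] := ses_ker se.
by exists (Presentation (ses_fg noethR sj (fg_rV R n)).1 sj).
Qed.

(** Conversely a free resolution is obtained by iterating a choice of finite
    presentations, and in it [Ext^1] of the last syzygy is computed. *)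
Lemma Ext_eq0_vanishes i N B : fg_module N -> Ext_eq0 i.+1 N B ->
  Ext_vanishes i.+1 N B.
Proof.
move=> fgN extN.
pose fgm := {X : lmodType R | fg_module X}.
pose pres (X : fgm) : presentation (sval X) := sval (cid (presentationP (svalP X))).
pose S n : fgm := iter n (fun X : fgm => exist _ _ (pr_fg (pres X)) : fgm) (exist _ N fgN).
pose C n : lmodType R := 'rV[R]_(pr_rank (pres (S n))).
pose d n : {linear C n.+1 -> C n} := pr_incl (pres (S n)) \o pr_proj (pres (S n.+1)).
have sS n : ses (pr_incl (pres (S n))) (pr_proj (pres (S n))) by exact: pr_ses.
exists C, d, (pr_proj (pres (S 0%N))); split.
- by move=> n; exact: projective_rV.
- split=> [|y|n y]; first by case: (sS 0%N).
    case: (sS 0%N) => _ _ ex; rewrite ex; case: (sS 1%N) => _ s1 _.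
    split=> [[x <-]|[x <-]]; first by have [z <-] := s1 x; exists z.
    by eexists; reflexivity.
  case: (sS n) => ij _ _; case: (sS n.+1) => _ _ ex; case: (sS n.+2) => _ s2 _.
  transitivity (pr_proj (pres (S n.+1)) y = 0).
    by split=> [E|/= ->]; [apply: ij; rewrite linear0|exact: linear0].
  rewrite ex; split=> [[x <-]|[x <-]]; first by have [z <-] := s2 x; exists z.
  by eexists; reflexivity.
have {extN} : Ext_eq0 1 (sval (S i)) B.
  have : forall m n, Ext_eq0 (m + n).+1 (sval (S 0%N)) B -> Ext_eq0 m.+1 (sval (S n)) B.
    move=> m n; elim: n m => [|n IHn] m; first by rewrite addn0.
    rewrite addnS -addSn => /IHn.
    move=> extS; have := ext_shift noethR m (ext_id B) (@projective_rV _ _) (pr_fg (pres (S n))) (sS n).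
    by move=> [+ _]; apply.
  by move=> /(_ 0%N i); apply.
move=> /ext1_extends /(_ (sS i)) ext f fd.
have [|f' Ef'] := factor_coker (f := f) (sS i.+1).
  move=> x; case: (sS i.+2) => _ s2 _.
  by have [z <-] := s2 x; exact: fd.
have [g Eg] := ext f'; exists g => x.
by rewrite -Ef' [RHS]Eg.
Qed.

End FreeResolution.
End ExtMore.


(** * Associated primes *)

Section AssociatedPrimes.
Variable R : comPzRingType.
Implicit Types (M N K P Q : lmodType R).

Definition ann M (m : M) : set R := [set a | a *: m = 0].

Definition max_ann M (m : M) : Prop :=
  m <> 0 /\ forall m' : M, m' <> 0 -> ann m `<=` ann m' -> ann m' `<=` ann m.

Lemma max_ann_prime M (m : M) : max_ann m -> prime_ideal (ann m).
Proof.
move=> [m0 max]; split; last 1 first.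
- move=> x y xym; have [ym|/eqP ym] := eqVneq (y *: m) 0; first by right.
  left; apply: (max (y *: m)) => //=; rewrite /ann /= ?scalerA // => a /= am.
  by rewrite scalerA mulrC -scalerA am scaler0.
- split=> [|x y /= xm ym|a x /= xm]; rewrite /ann /= ?scale0r //.
    by rewrite scalerDl xm ym addr0.
  by rewrite -scalerA xm scaler0.
- by rewrite /ann /= scale1r.
Qed.

Lemma submodule_ann M (m : M) : submodule (ann m : set R^o).
Proof.
split=> [|a x y /= xm ym]; rewrite /ann /= ?scale0r //.
by rewrite scalerDl -scalerA xm ym scaler0 addr0.
Qed.

Lemma fg_regular : fg_module R^o.
Proof.
exists 1%N, (fun=> 1) => x; exists (fun=> x); rewrite big_ord1.
by rewrite /GRing.scale /= mulr1.
Qed.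

Lemma prime_prod (p : set R) n (a : 'I_n -> R) :
  prime_ideal p -> p (\prod_i a i) -> exists i, p (a i).
Proof.
move=> [idp p1 pM]; elim: n a => [|n IHn] a; first by rewrite big_ord0.
rewrite big_ord_recl => /pM [?|/IHn [i ?]]; first by exists ord0.
by exists (lift ord0 i).
Qed.

Lemma ideal_prod (I : set R) n (a : 'I_n -> R) i :
  ideal I -> I (a i) -> I (\prod_i a i).
Proof. by move=> [_ _ IM] Ia; rewrite (bigD1 i) //= mulrC; exact: IM. Qed.

(** If [I] lay in no [p i], choose [x i] in [I] avoiding all the other primes,
    hence lying in [p i]. With at least two primes, the element
    [x 0 + x 1 ... x n] of [I] then avoids them all. *)
Lemma prime_avoidance (I : set R) n (p : 'I_n -> set R) :
    ideal I -> (forall i, prime_ideal (p i)) ->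
    (forall x, I x -> exists i, p i x) -> exists i, I `<=` p i.
Proof.
move=> idI; elim: n p => [|n IHn] p prp cov.
  by have [[]] := cov 0 (let: And3 I0 _ _ := idI in I0).
apply: contrapT => no.
have next i : exists x, I x /\ forall j, j != i -> ~ p j x.
  apply: contrapT => nox; apply: no.
  have [|x Ix|j Ij] := IHn (fun j => p (lift i j)) => //; last by exists (lift i j).
  apply: contrapT => nop; apply: nox; exists x; split=> // k ki pk.
  by case: (unliftP i k) ki pk => [j ->|->]; rewrite ?eqxx // => _ pj; apply: nop; exists j.
have /choice [x Ex] := next.
have xp i : p i (x i).
  have [Ix Nx] := Ex i; have [j pj] := cov _ Ix.
  by have [E|/Nx nj] := eqVneq j i; [rewrite -{1}E|case: (nj pj)].
case: idI => _ ID IM.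
case: n => [|n] in IHn p prp cov no next x Ex xp *.
  apply: no; exists ord0 => y /cov [i].
  by rewrite ord1.
pose y := \prod_i x (lift ord0 i).
have Iy : I y by rewrite /y big_ord_recl mulrC; apply: IM; case: (Ex (lift ord0 ord0)).
have [k pk] := cov _ (ID _ _ (Ex ord0).1 Iy).
have [idk k1 kM] := prp k; case: (idk) => k0 kD kMl.
have kN u v : p k (u + v) -> p k u -> p k v.
  move=> puv pu; rewrite -(addKr u v); apply: kD => //.
  by rewrite -mulN1r; exact: kMl.
case: (unliftP ord0 k) pk => [j|] Ek pk; subst k; last first.
  have /prime_prod [//|j pj] := kN _ _ pk (xp ord0).
  by case: (Ex (lift ord0 j)) => _ /(_ ord0); apply; rewrite ?neq_lift.
have py : p (lift ord0 j) y by apply: (ideal_prod (i := j)).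
have /kN := pk; rewrite addrC in pk; have /kN /(_ py) := pk.
by case: (Ex ord0) => _ /(_ (lift ord0 j)); rewrite eq_sym neq_lift => /(_ isT).
Qed.

Hypothesis noethR : noetherian R.

Lemma max_ann_exists M (m0 : M) : m0 <> 0 ->
  exists m : M, max_ann m /\ ann m0 `<=` ann m.
Proof.
move=> m0n.
have [|||S [m [mn sm ->]] maxS] := noetherian_max (M := R^o) noethR
    (F := [set S : set R^o | exists m : M, [/\ m <> 0, ann m0 `<=` ann m & S = ann m]]).
- exact: fg_regular.
- by move=> S [m [_ _ ->]]; exact: submodule_ann.
- by exists (ann m0), m0; split=> //; exact: subset_refl.
exists m; do 2![split=> //] => m' m'n mm'; apply: maxS => //.
by exists m'; split=> //; exact: subset_trans sm mm'.
Qed.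

(** Prime avoidance over the maximal annihilators. Only finitely many of them
    occur in a finitely generated module: the elements realising them generate
    a finitely generated submodule, and an annihilator containing a finite
    intersection of the others contains one of them. *)
Lemma ideal_kills_element M (I : set R) : fg_module M -> ideal I ->
    (forall x, I x -> exists2 m : M, m <> 0 & x *: m = 0) ->
  exists2 m : M, m <> 0 & forall x, I x -> x *: m = 0.
Proof.
move=> fgM idI zd.
pose spanned n (s : 'I_n -> M) : set M := [set y | exists c, comb s c = y].
have [||T [n [s [maxs ->]]] maxT] := noetherian_max noethR (M := M)
    (F := [set T | exists n (s : 'I_n -> M),
                     (forall i, max_ann (s i)) /\ T = spanned n s]) fgM.
- by move=> T [n [s [_ ->]]]; exact: submodule_img.
- exists (spanned 0%N (fun=> 0)), 0%N, (fun=> 0); split=> //.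
  by case.
have span_s m : max_ann m -> spanned n s m.
  move=> maxm.
  pose s' (i : 'I_n.+1) := if unlift ord0 i is Some j then s j else m.
  apply: (maxT (spanned _ s')).
  - exists n.+1, s'; split=> // i; rewrite /s'.
    by case: unliftP => [j _|_].
  - move=> _ [c <-]; exists (\row_i (if unlift ord0 i is Some j then c 0 j else 0)).
    rewrite /= /lin_fun big_ord_recl mxE unlift_none scale0r add0r.
    by apply: eq_bigr => i _; rewrite !mxE /s' liftK.
  - exists (delta_mx 0 ord0); rewrite comb_delta /s'.
    by rewrite unlift_none.
have [||i si] := prime_avoidance (p := fun i => ann (s i)) idI.
- by move=> i; exact: max_ann_prime.
- move=> x /zd [m mn xm]; have [m' [maxm' mm']] := max_ann_exists mn.
  have [c Ec] := span_s _ maxm'.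
  have [i si] : exists i, ann (s i) `<=` ann m'.
    apply: contrapT => no.
    have /choice [a Ea] : forall i, exists a, ann (s i) a /\ ~ ann m' a.
      move=> i; apply: contrapT => noa; apply: no; exists i => a ai.
      by apply: contrapT => am; apply: noa; exists a.
    have /prime_prod : ann m' (\prod_i a i).
      rewrite /ann /= -Ec /= /lin_fun scaler_sumr big1 // => i _.
      have [ai _] := Ea i.
      rewrite scalerA mulrC -scalerA.
      have -> : (\prod_i a i) *: s i = 0; last by rewrite scaler0.
      have [+ _ _] := max_ann_prime (maxs i).
      by move=> idi; exact: (ideal_prod (I := ann (s i)) (i := i)).
    case=> [|i ami]; first exact: max_ann_prime.
    by have [_] := Ea i; apply.
  by exists i; exact: ((maxs i).2 m' maxm'.1 si _ (mm' _ xm)).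
by exists (s i) => [|x /si //]; case: (maxs i).
Qed.

End AssociatedPrimes.


(** * Depth and Ext over a noetherian local ring *)

Section SupremumInt.
Local Open Scope ereal_scope.

(** A bounded set has a maximum, and only infinity bounds an unbounded one; this
    is how the supremum that defines the depth is compared with integers. *)
Lemma supremum_nat (P : nat -> Prop) (x0 : \bar int) n0 : P n0 ->
  let s := supremum x0 [set n%:Z%:E | n in [set n | P n]] in
  (exists N, [/\ s = N%:Z%:E, P N & forall n, P n -> (n <= N)%N]) \/
  (s = +oo /\ forall b, exists2 n, P n & (b < n)%N).
Proof.
move=> Pn0; set S := [set _ | _ in _] => s.
have supE y : supremums S y -> s = y.
  move=> Sy; rewrite /s /supremum ifF; last first.
    by apply/negbTE/set0P; exists n0%:Z%:E; exists n0.
  have Ss : supremums S (xget x0 (supremums S)) by apply: xgetPex; exists y.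
  exact: is_subset1_supremums Ss Sy.
have [[b Pb]|unb] := pselect (exists b, forall n, P n -> (n <= b)%N).
  left; have exP : exists n, `[< P n >] by exists n0; exact/asboolP.
  have bP n : `[< P n >] -> (n <= b)%N by move=> /asboolP; exact: Pb.
  case: (ex_maxnP exP bP) => N /asboolP PN maxN.
  exists N; split=> // [|n Pn]; last by apply: maxN; exact/asboolP.
  apply: supE; split=> [_ [n Pn <-]|y /(_ N%:Z%:E)]; last by apply; exists N.
  by rewrite lee_fin lez_nat; apply: maxN; exact/asboolP.
have big b : exists2 n, P n & (b < n)%N.
  apply: contrapT => no; apply: unb; exists b => n Pn.
  by rewrite leqNgt; apply/negP => bn; apply: no; exists n.
right; split=> //; apply: supE; split=> [y _|y ub]; first exact: leey.
case: y ub => [z|//|] ub; last first.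
  by have := ub n0%:Z%:E (ex_intro2 _ _ n0 Pn0 erefl).
have [n Pn] := big `|z|%N; have := ub n%:Z%:E (ex_intro2 _ _ n Pn erefl).
rewrite lee_fin => nz /(leq_trans _) lt; exfalso.
have : (n%:Z <= `|z|%N%:Z)%R by apply: le_trans nz _; rewrite abszE ler_norm.
by rewrite lez_nat leqNgt lt.
Qed.

End SupremumInt.

Section LocalRing.
Variable A : comPzRingType.
Hypothesis noethA : noetherian A.
Hypothesis localA : ideal (@nonunits A).
Implicit Types (E M N K P Q : lmodType A).

(** [k] is a copy of the residue field of [A]. *)
Definition residue (k : lmodType A) : Prop :=
  exists q : {linear A^o -> k}, surj q /\ forall a, q a = 0 <-> nonunits a.

Lemma submodule_ideal (I : set A) : ideal I -> submodule (I : set A^o).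
Proof.
by move=> [I0 ID IM]; split=> // a x y Ix Iy; apply: ID => //; exact: IM.
Qed.

Lemma residue_exists : exists k : lmodType A, residue k.
Proof.
by have [k [q Eq]] := submodule_quot (submodule_ideal localA); exists k, q.
Qed.

Lemma nonunits1 : ~ nonunits (1 : A).
Proof. by apply; exists 1; rewrite mulr1. Qed.

Lemma unit_or_nonunit (a : A) : nonunits a \/ exists y, y * a = 1.
Proof. by have [?|?] := pselect (exists y, y * a = 1); [right|left]. Qed.

Lemma scale_lin M (m : M) : linear (fun a : A^o => (a : A) *: m).
Proof. by move=> a x y; rewrite scalerDl scalerA. Qed.

(** Through the quotient of [E] by a maximal proper submodule, which is simple. *)
Lemma fg_to_residue (k : lmodType A) (q : {linear A^o -> k}) E (e0 : E) :
    surj q -> (forall a, q a = 0 <-> nonunits a) -> fg_module E -> e0 <> 0 ->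
  exists (chi : {linear E -> k}) (e : E), chi e = q 1.
Proof.
move=> sq kq fgE e00.
have [||U [subU neU] maxU] := noetherian_max noethA (M := E)
    (F := [set S | submodule S /\ exists x, ~ S x]) fgE.
- by move=> S [].
- exists [set 0]; split=> [|]; last by exists e0.
  by split=> //= a x y -> ->; rewrite scaler0 addr0.
have [e eU] := neU; case: (subU) => U0 UD.
have U_ x y : U x -> U y -> U (x + y).
  by move=> ? ?; rewrite -(scale1r x); exact: UD.
have UZ a x : U x -> U (a *: x).
  by move=> ?; rewrite -[_ *: _]addr0; exact: UD.
have gen z : ~ U z -> forall x, exists a, U (x - a *: z).
  move=> Uz x; apply: contrapT => no; apply: (Uz).
  apply: (maxU [set w | exists a, U (w - a *: z)]).
  - split; last by exists x.
    split=> [|c w w' [a wa] [a' wa']] /=; first by exists 0; rewrite scale0r subr0.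
    exists (c * a + a'); rewrite scalerDl -scalerA opprD addrACA -scalerBr.
    exact: UD.
  - by move=> w Uw; exists 0; rewrite scale0r subr0.
  - by exists 1; rewrite scale1r subrr.
have nonU a : nonunits a <-> U (a *: e).
  split=> [na|Ua [y ya]]; last first.
    by apply: eU; rewrite -(scale1r e) -ya -scalerA; exact: UZ.
  apply: contrapT => /gen /(_ e) [b].
  rewrite scalerA -[X in X - _]scale1r -scalerBl => Uba; apply: eU.
  case: localA => _ ID IM.
  have [nb|[y yb]] := unit_or_nonunit (1 - b * a).
    by case: nonunits1; rewrite -(subrK (b * a) 1); apply: ID => //; exact: IM.
  by rewrite -(scale1r e) -yb -scalerA; exact: UZ.
have [|||chi Echi] := @linear_of_rel _ E k
    (fun x y => exists a, U (x - a *: e) /\ y = q a).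
- by move=> x; have [a Ua] := gen e eU x; exists (q a), a.
- move=> c x1 _ x2 _ [a1 [U1 ->]] [a2 [U2 ->]].
  exists (c * a1 + a2); split; last by rewrite -linearP.
  rewrite scalerDl -scalerA opprD addrACA -scalerBr; exact: UD.
- move=> _ [a [Ua ->]]; apply/kq/nonU.
  by rewrite -[_ *: _]opprK -scaleN1r; apply: UZ; rewrite -[- _]add0r.
exists chi, e; apply/Echi; exists 1; split=> //.
by rewrite scale1r subrr.
Qed.

Variable k : lmodType A.
Hypothesis resk : residue k.

Lemma fg_residue : fg_module k.
Proof. by have [q [sq _]] := resk; apply: fg_surj sq (fg_regular _). Qed.

Lemma residue_kill a (x : k) : nonunits a -> a *: x = 0.
Proof.
have [q [sq kq]] := resk; have [b <-] := sq x; rewrite -linearZ => na.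
by apply/kq; rewrite /GRing.scale /= mulrC; case: localA => _ _; exact.
Qed.

Lemma hom_residue M : Ext_eq0 0 k M <->
  forall m : M, (forall a, nonunits a -> a *: m = 0) -> m = 0.
Proof.
have [q [sq kq]] := resk; split=> [ext m km|km f x].
  have [|f Ef] := factor_surj (f := Lin (scale_lin m)) sq.
    by move=> a /kq; exact: km.
  have := ext f (q 1); rewrite /= Ef /= /lin_fun scale1r; exact.
have [a <-] := sq x; apply: km => b nb.
have : f (b *: q a) = 0 by rewrite residue_kill ?linear0.
by rewrite linearZ.
Qed.

(** Nakayama: [M] is not [x M], as [x M] dies in a residue field quotient. *)
Lemma nakayama_quot M Q (c : {linear M -> Q}) x (m0 : M) : fg_module M ->
    m0 <> 0 -> nonunits x -> (forall m, c m = 0 <-> exists m', x *: m' = m) ->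
  exists m, c m <> 0.
Proof.
move=> fgM m00 nx Ec; have [q [sq kq]] := resk.
have [chi [e Ee]] := fg_to_residue sq kq fgM m00.
exists e => /Ec [m' Em]; apply: nonunits1; apply/kq.
by rewrite -Ee -Em linearZ /= residue_kill.
Qed.

Lemma ses_scale M x : (forall m : M, x *: m = 0 -> m = 0) ->
  exists (Q : lmodType A) (c : {linear M -> Q}), ses (x \*: ext_id M) c.
Proof. by move=> rx; apply: ses_coker; apply: inj_linear => m; exact: rx. Qed.

(** Dividing [M] by the first term of a sequence shifts the sequence by one. *)
Lemma partial_ideal_quot M Q n (x : 'I_n.+1 -> A) (c : {linear M -> Q}) (i : nat) m :
    ses (x ord0 \*: ext_id M) c ->
  in_partial_ideal (fun j => x (lift ord0 j)) i (c m) <-> in_partial_ideal x i.+1 m.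
Proof.
case=> _ sc ex; split=> [[d Ed]|[d ->]]; last first.
  exists (fun j => c (d (lift ord0 j))).
  rewrite big_mkcond big_ord_recl /= linearD.
  have -> : c (x ord0 *: d ord0) = 0 by apply/ex; exists (d ord0).
  rewrite add0r linear_sum [in RHS]big_mkcond; apply: eq_bigr => j _.
  by rewrite /= ltnS; case: ifP => _; rewrite ?linearZ ?linear0.
have /choice [d' Ed'] := fun j => sc (d j).
have /ex [m' Em] : c (m - \sum_(j < n | (j < i)%N) x (lift ord0 j) *: d' j) = 0.
  rewrite linearB Ed linear_sum -sumrB big1 // => j _.
  by rewrite linearZ Ed' subrr.
exists (fun j => if unlift ord0 j is Some j' then d' j' else m').
rewrite -[LHS](subrK (\sum_(j < n | (j < i)%N) x (lift ord0 j) *: d' j)) -Em.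
rewrite [in RHS]big_mkcond big_ord_recl /= unlift_none; congr (_ + _).
rewrite big_mkcond; apply: eq_bigr => j _.
by rewrite /= ltnS liftK.
Qed.

Lemma partial_ideal0 M n (x : 'I_n -> A) (m : M) : in_partial_ideal x 0 m <-> m = 0.
Proof.
split=> [[c ->]|->]; first by rewrite big_pred0.
by exists (fun=> 0); rewrite big_pred0.
Qed.

(** Rees: multiplication by the first term is injective on [M] and kills
    [Ext(k, M)], which is therefore controlled by [Ext(k, M / x M)]. *)
Lemma ext_of_regular M n (x : 'I_n -> A) : regular_sequence M x ->
  forall l, (l < n)%N -> Ext_eq0 l k M.
Proof.
elim: n M x => [//|n IHn] M x [nx rx [m0 Em0]] [_|l].
  apply/hom_residue => m km; apply/(partial_ideal0 x)/(rx ord0).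
  by apply/partial_ideal0; exact/km/nx.
rewrite ltnS => ln.
have [|Q [c sc]] := @ses_scale M (x ord0).
  by move=> m Em; apply/(partial_ideal0 x)/(rx ord0)/partial_ideal0.
have extQ : Ext_eq0 l k Q.
  apply: (IHn Q (fun j => x (lift ord0 j))) => //; case: (sc) => _ surjc _.
  split=> [i //|i m|]; last by exists (c m0); rewrite partial_ideal_quot.
  have [m' <-] := surjc m; rewrite -linearZ !(partial_ideal_quot _ _ sc).
  exact: rx.
apply: (ext_ker noethA sc) extQ; first exact: fg_residue.
apply: stably_kills_ext => //; first exact: fg_residue.
by apply: annihilated_stably_kills => y; exact: residue_kill.
Qed.

(** Rees: when [Hom(k, M)] is zero, prime avoidance yields a regular element,
    and [M / x M] has lost one degree of vanishing. *)
Lemma regular_of_ext M n : fg_module M -> ~ zero_module M ->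
  (forall l, (l < n)%N -> Ext_eq0 l k M) -> exists x : 'I_n -> A, regular_sequence M x.
Proof.
move=> fgM nzM; have {nzM} [m0 nm0] : exists m : M, m <> 0.
  by apply: contrapT => no; apply: nzM => m; apply: contrapT => ?; apply: no; exists m.
elim: n M m0 nm0 fgM => [|n IHn] M m0 nm0 fgM ext.
  exists (fun=> 0); split=> [[]//|[]//|].
  by exists m0 => /partial_ideal0.
have [x0 [nx0 rx0]] : exists x0 : A,
    nonunits x0 /\ forall m : M, x0 *: m = 0 -> m = 0.
  apply: contrapT => no.
  have [|m nm km] := ideal_kills_element noethA (M := M) fgM localA.
    move=> x nx; apply: contrapT => nom; apply: no; exists x; split=> // m xm.
    by apply: contrapT => nm; apply: nom; exists m.
  by apply: nm; apply: (hom_residue M).1 => //; exact: (ext 0%N).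
have [Q [c sc]] := ses_scale rx0; case: (sc) => _ surjc exc.
have [m1 cm1] := nakayama_quot fgM nm0 nx0 exc.
have [||x Ex] := IHn Q (c m1) cm1; first exact: fg_surj surjc fgM.
  move=> l ln; apply: (ext_coker noethA sc); first exact: fg_residue.
    by apply: ext; rewrite ltnS ltnW.
  exact: ext.
case: Ex => nx rx [mQ EmQ].
pose x' (i : 'I_n.+1) := if unlift ord0 i is Some j then x j else x0.
have x'l j : x' (lift ord0 j) = x j by rewrite /x' liftK.
have x'0 : x' ord0 = x0 by rewrite /x' unlift_none.
have Ex : x = fun j => x' (lift ord0 j) by apply/funext => j; rewrite x'l.
have sc' : ses (x' ord0 \*: ext_id M) c by rewrite x'0.
exists x'; split.
- by move=> i; rewrite /x'; case: unliftP.
- move=> i m; case: (unliftP ord0 i) => [j|] ->; last first.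
    by rewrite !partial_ideal0 x'0; exact: rx0.
  rewrite /= -!(partial_ideal_quot _ _ sc') linearZ x'l -Ex.
  exact: rx.
- have [m Em] := surjc mQ; exists m.
  by rewrite -(partial_ideal_quot _ _ sc') -Ex Em.
Qed.

Lemma depth_geP M n : fg_module M ->
  ((n%:Z)%:E <= depth M)%E <-> forall l, (l < n)%N -> Ext_eq0 l k M.
Proof.
move=> fgM; rewrite /depth; case: asboolP => [z0|nz].
  split=> [_ l _|_]; last exact: leey.
  exact: ext_zero_r noethA _ _ _ fg_residue z0.
have [|x0 reg0] := @regular_of_ext M 0 fgM nz; first by [].
have := @supremum_nat (fun n => exists x : 'I_n -> A, regular_sequence M x)
  0%E 0%N (ex_intro _ x0 reg0).
case=> [[N [-> [x regx] maxN]]|[-> big]]; split=> [nN l ln|ext].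
- apply: (ext_of_regular regx); apply: leq_trans ln _.
  by move: nN; rewrite lee_fin lez_nat.
- by rewrite lee_fin lez_nat; apply: maxN; exact: regular_of_ext.
- by have [m [x regx] nm] := big n; exact: (ext_of_regular regx (ltn_trans ln nm)).
- exact: leey.
Qed.

Lemma depth_value M : fg_module M ->
  (exists N : nat, depth M = (N%:Z)%:E) \/ depth M = +oo%E.
Proof.
move=> fgM; rewrite /depth; case: asboolP => [z0|nz]; first by right.
have [|x0 reg0] := @regular_of_ext M 0 fgM nz; first by [].
have := @supremum_nat (fun n => exists x : 'I_n -> A, regular_sequence M x)
  0%E 0%N (ex_intro _ x0 reg0).
by case=> [[N [-> _ _]]|[-> _]]; [left; exists N|right].
Qed.

End LocalRing.


(** * Duals *)

Section Duals.
Variable R : comPzRingType.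
Implicit Types (B G M N K P Q D X Z : lmodType R).

Lemma inj_surj_bijective (T U : Type) (f : T -> U) :
  injective f -> (forall y, exists x, f x = y) -> bijective f.
Proof.
move=> fi /choice [g Eg]; exists g => // x.
by apply: fi; rewrite Eg.
Qed.

Lemma dual_mapE M N (f : {linear M -> N}) (phi : dual N) x :
  dual_app (dual_map f phi) x = dual_app phi (f x).
Proof. by []. Qed.

Lemma dual_app_linear M (phi : dual M) : linear (dual_app phi).
Proof. by move=> a x y; rewrite /dual_app linearP. Qed.

Lemma dual_appD M (phi psi : dual M) x :
  dual_app (phi + psi) x = dual_app phi x + dual_app psi x.
Proof. by []. Qed.

Lemma dual_appZ M a (phi : dual M) x :
  dual_app (a *: phi) x = (a : R) * dual_app phi x.
Proof. by []. Qed.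

Lemma dual_app_sum M n (phi : 'I_n -> dual M) x :
  dual_app (\sum_i phi i) x = \sum_i dual_app (phi i) x.
Proof.
by apply: (big_morph (fun psi : dual M => dual_app psi x)).
Qed.

Lemma bidual_linear M : linear (@bidual R M).
Proof. by move=> a x y; apply: dualP => phi; exact: dual_app_linear. Qed.
Definition bidual_lin M : {linear M -> dual (dual M)} := Lin (@bidual_linear M).

Lemma bidualE M (x : M) (phi : dual M) : dual_app (bidual x) phi = dual_app phi x.
Proof. by []. Qed.

Definition swap_fun M N (f : {linear M -> dual N}) (y : N) (x : M) : R^o :=
  dual_app (f x) y.

Lemma swap_fun_linear M N (f : {linear M -> dual N}) (y : N) : linear (swap_fun f y).
Proof. by move=> a x x'; rewrite /swap_fun linearP. Qed.

Lemma swap_linear M N (f : {linear M -> dual N}) :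
  linear (fun y => Lin (swap_fun_linear f y) : dual M).
Proof. by move=> a y y'; apply: dualP => x; exact: dual_app_linear. Qed.

(** The symmetry of bilinear maps: a map [M -> dual N] is a pairing of [M] and
    [N]. *)
Definition swap M N (f : {linear M -> dual N}) : {linear N -> dual M} :=
  Lin (swap_linear f).

Lemma swapE M N (f : {linear M -> dual N}) x y :
  dual_app (swap f y) x = dual_app (f x) y.
Proof. by []. Qed.

Lemma dual_left_exact K P N (f : {linear K -> P}) (e : {linear P -> N}) :
    surj e -> exact_at f e ->
  injective (dual_map e) /\ exact_at (dual_map e) (dual_map f).
Proof.
move=> se ex; split=> [phi psi E|phi].
  by apply: dualP => y; have [x <-] := se y; rewrite -!dual_mapE E.
split=> [E|[psi <-]].
  have [|g Eg] := factor_surj (f := phi) se.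
    move=> x /ex [w <-]; exact: (congr1 (fun psi : dual K => dual_app psi w) E).
  by exists (g : dual N); apply: dualP => x; exact: Eg.
apply: dualP => w.
by rewrite !dual_mapE (ex _).2 ?/dual_app ?linear0 //; exists w.
Qed.

Lemma ses_dual K P N (j : {linear K -> P}) (e : {linear P -> N}) :
  ses j e -> extends (ext_id R^o) j -> ses (dual_map e) (dual_map j).
Proof.
move=> [_ se ex] ext; have [ie exe] := dual_left_exact se ex; split=> // phi.
have [g Eg] := ext phi; exists (g : dual P).
by apply: dualP => x; exact: Eg.
Qed.

(** The coordinate functions of a projective module, which give the maps needed
    for its dual and its bidual. *)
Lemma dual_basis P : fg_projective P ->
  exists n (p : 'I_n -> P) (eps : 'I_n -> dual P),
    forall x, x = \sum_i (dual_app (eps i) x : R) *: p i.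
Proof.
move=> /fg_projectiveP [n [r [s rs]]].
have cl k : linear (fun x : P => s x 0 k : R^o).
  by move=> a x y; rewrite linearP !mxE.
exists n, (fun i => r (delta_mx 0 i)), (fun i => Lin (cl i) : dual P) => x.
rewrite -[LHS]rs {1}(row_sum_delta (s x)) linear_sum.
by apply: eq_bigr => k _; rewrite linearZ.
Qed.

Lemma dual_basis_dual P n (p : 'I_n -> P) (eps : 'I_n -> dual P) (phi : dual P) :
  (forall x, x = \sum_i (dual_app (eps i) x : R) *: p i) ->
  phi = \sum_i (dual_app phi (p i) : R) *: eps i.
Proof.
move=> E; apply: dualP => x; rewrite dual_app_sum {1}(E x).
rewrite /dual_app linear_sum; apply: eq_bigr => i _.
by rewrite linearZ; exact: mulrC.
Qed.

Lemma fg_projective_dual P : fg_projective P -> fg_projective (dual P).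
Proof.
move=> /dual_basis [n [p [eps E]]]; apply/fg_projectiveP.
have sl : linear (fun phi : dual P => \row_i (dual_app phi (p i) : R)).
  by move=> a x y; apply/rowP => i; rewrite !mxE.
exists n, (comb eps), (Lin sl) => phi.
rewrite {2}(dual_basis_dual phi E) /= /lin_fun.
by apply: eq_bigr => i _; rewrite mxE.
Qed.

Lemma fg_projective_reflexive P : fg_projective P -> reflexive_module P.
Proof.
move=> /dual_basis [n [p [eps E]]]; apply: inj_surj_bijective.
  move=> x y Exy; rewrite (E x) (E y); apply: eq_bigr => i _.
  by have /(congr1 (fun T : dual (dual P) => dual_app T (eps i))) := Exy; rewrite !bidualE => ->.
move=> T; exists (\sum_i (dual_app T (eps i) : R) *: p i).
apply: dualP => phi; rewrite bidualE [in RHS](dual_basis_dual phi E).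
rewrite /dual_app !linear_sum; apply: eq_bigr => i _.
by rewrite !linearZ; exact: mulrC.
Qed.

Lemma reflexive_inj M (x y : M) : reflexive_module M ->
  (forall phi : dual M, dual_app phi x = dual_app phi y) -> x = y.
Proof. by move=> /bij_inj bi E; apply: bi; apply: dualP => phi; exact: E. Qed.

(** Maps to a reflexive [M] are prescribed by functionals on [dual M]. *)
Lemma reflexive_lift M N (f : {linear N -> dual (dual M)}) : reflexive_module M ->
  exists g : {linear N -> M}, forall x phi, dual_app phi (g x) = dual_app (f x) phi.
Proof.
move=> [h hK Kh].
have [||g Eg] := factor_inj (j := bidual_lin M) (f := f).
- by move=> x y; exact: (can_inj hK).
- by move=> x; exists (h (f x)); exact: Kh.
by exists g => x phi; rewrite -Eg.
Qed.

Lemma reflexive_dominated M : reflexive_module M -> dominated M (dual (dual M)).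
Proof.
move=> refM; have [g Eg] := reflexive_lift (ext_id (dual (dual M))) refM.
apply: (retract_dominated (s := bidual_lin M) (r := g)) => x.
by apply: (reflexive_inj refM) => phi; rewrite Eg.
Qed.

Hypothesis noethR : noetherian R.

Lemma fg_dual M : fg_module M -> fg_module (dual M).
Proof.
move=> /fgP [n [r sr]].
have sl : linear (fun phi : dual M => \row_i (dual_app phi (r (delta_mx 0 i)) : R)).
  by move=> a x y; apply/rowP => i; rewrite !mxE.
apply: (@fg_sub_rV R noethR n _ (Lin sl)) => phi psi /rowP E.
apply: dualP => x; have [c <-] := sr x.
apply: (@eq_rV _ _ _ (phi \o r : {linear _ -> R^o}) (psi \o r : {linear _ -> R^o})) => i.
by have := E i; rewrite !mxE.
Qed.

(** By the symmetry of bilinear maps, to extend a map [S -> dual D] from a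
    syzygy [S] of [X] is to lift a map from [D] to [dual S]. The obstruction
    lies in [Ext^1(D, dual X)], as long as [Ext^1(X, R)] is zero. *)
Lemma ext_to_dual l X D : fg_module X -> fg_module D ->
    (forall i, (i <= l)%N -> Ext_eq0 i.+1 X R^o) ->
    (forall i, Ext_eq0 i.+1 D R^o) -> (forall i, Ext_eq0 i.+1 D (dual X)) ->
  Ext_eq0 l.+1 X (dual D).
Proof.
move=> + fgD; elim: l X => [|l IHl] X fgX extX extD extDX;
  have [S [F [j [e [fgS [fgF pF] sje]]]]] := fg_cover noethR fgX;
  have extj := (ext1_shift _ pF sje).1 (extX 0%N isT);
  have sdu := ses_dual sje extj.
  apply/(ext1_shift _ pF sje) => f.
  have [K [P [j' [e' [_ [_ pP] sje']]]]] := fg_cover noethR fgD.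
  have [g Eg] := ext1_lift sdu pP sje' ((ext1_shift _ pP sje').1 (extDX 0%N)) (swap f).
  exists (swap g) => x; apply: dualP => y.
  by rewrite swapE -dual_mapE Eg swapE.
apply/(ext_shift noethR _ _ pF fgS sje); apply: IHl => // [i il|i].
  by apply/(ext_shift noethR _ _ pF fgS sje); exact: (extX i.+1 il).
apply: (ext_coker noethR sdu) => //.
by apply: ext_dominated (extD i); apply: fg_projective_dominated; exact: fg_projective_dual.
Qed.

(** Total reflexivity, in terms of the stepwise vanishing of Ext. *)
Definition totref G : Prop :=
  [/\ fg_module G, reflexive_module G, forall i, Ext_eq0 i.+1 G R^o
    & forall i, Ext_eq0 i.+1 (dual G) R^o].

(** [N] has Gorenstein dimension less than [m]: a resolution of length [m - 1]
    is built one totally reflexive cover at a time. *)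
Fixpoint Gdim_lt (m : nat) N : Prop :=
  match m with
  | 0 => zero_module N
  | m'.+1 => exists (K G : lmodType R) (a : {linear K -> G}) (c : {linear G -> N}),
      [/\ totref G, ses a c & Gdim_lt m' K]
  end.

Lemma totref_projective P : fg_projective P -> totref P.
Proof.
move=> fP; have [fgP pP] := fP; split=> //.
- exact: fg_projective_reflexive.
- by move=> i; exact: ext_projective.
- by move=> i; apply: ext_projective; case: (fg_projective_dual fP).
Qed.

Lemma zero_totref Z : zero_module Z -> totref Z.
Proof.
by move=> z0; apply: totref_projective; split; [exact: zero_fg|exact: zero_projective].
Qed.

(** Once functionals extend from [K] to [G], the dual sequence is exact, and so
    is its dual because [Ext^1(dual K, R)] is zero; hence [N] is reflexive. *)
Lemma totref_coker K G N (a : {linear K -> G}) (c : {linear G -> N}) :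
    ses a c -> totref K -> totref G -> extends (ext_id R^o) a -> totref N.
Proof.
move=> sac [fgK refK extK extK'] [fgG refG extG extG'] exta.
have sdu := ses_dual sac exta; split.
- exact: (ses_fg noethR sac fgG).2.
- have ext1K' := ext1_extends (extK' 0%N) sdu.
  case: (sac) => _ sc _; apply: inj_surj_bijective.
    apply: (@inj_linear _ _ _ (bidual_lin N)) => y; have [x <-] := sc y => E0.
    have [|G0 EG0] := factor_coker (f := bidual x) sdu.
      by move=> phi; have := congr1 (fun T : dual (dual N) => dual_app T phi) E0.
    have [h _ hK] := refK; pose k0 := h (G0 : dual (dual K)).
    have -> : x = a k0; last exact: ses0.
    apply: (reflexive_inj refG) => phi.
    rewrite -dual_mapE -[dual_app _ k0]bidualE hK.
    exact/esym/EG0.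
  move=> T; have [g Eg] := ext1K' T.
  have [h _ hK] := refG; exists (c (h (g : dual (dual G)))); apply: dualP => phi.
  by rewrite bidualE -dual_mapE -bidualE hK; exact: Eg.
- case=> [|i]; first exact: (ext1_right noethR sac).
  exact: (ext_right noethR sac fgG).
- move=> i; apply: (ext_left noethR sdu) => //; exact: fg_dual.
Qed.

End Duals.


(** * The Auslander--Bridger inequality *)

Section AuslanderBridger.
Variable A : comPzRingType.
Hypothesis noethA : noetherian A.
Hypothesis localA : ideal (@nonunits A).
Implicit Types (M N K P Q X D G : lmodType A).
Variable k : lmodType A.
Hypothesis resk : residue k.

Let fgk : fg_module k := fg_residue resk.

Lemma dual_residue_zero : Ext_eq0 0 k A^o -> zero_module (dual k).
Proof. by move=> ext phi; apply: dualP => x; exact: ext. Qed.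

(** The case [X = k] of [ext_to_dual], since [dual k] is zero when [d] is
    positive. *)
Lemma ext_residue_dual d D : fg_module D -> (forall i, Ext_eq0 i.+1 D A^o) ->
    (forall l, (l < d)%N -> Ext_eq0 l k A^o) ->
  forall l, (l < d)%N -> Ext_eq0 l k (dual D).
Proof.
move=> fgD extD extk [|l] ld.
  move=> f x; apply: dualP => y; transitivity (dual_app (swap f y) x) => //.
  by rewrite (dual_residue_zero (extk 0%N ld) (swap f y)).
apply: ext_to_dual => // [i il|i]; first exact: (extk i.+1 (leq_ltn_trans (il : (i.+1 <= l.+1)%N) ld)).
apply: ext_zero_r => //; exact: (dual_residue_zero (extk 0%N (leq_ltn_trans (leq0n _) ld))).
Qed.

Lemma ext_residue_totref d G : totref G ->
    (forall l, (l < d)%N -> Ext_eq0 l k A^o) ->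
  forall l, (l < d)%N -> Ext_eq0 l k G.
Proof.
move=> [fgG refG _ extG'] extk l ld.
apply: (ext_dominated (reflexive_dominated refG)).
by apply: ext_residue_dual ld => //; exact: fg_dual.
Qed.

Section Restriction.
Variables (K G N : lmodType A) (a : {linear K -> G}) (c : {linear G -> N}).
Hypotheses (sac : ses a c) (trK : totref K) (trG : totref G).

Let fgK' : fg_module (dual K). Proof. by case: trK => fgK _ _ _; exact: fg_dual. Qed.
Let refK : reflexive_module K. Proof. by case: trK. Qed.
Let refG : reflexive_module G. Proof. by case: trG. Qed.

(** If some functional on [K] does not extend, the cokernel of the restriction
    map is a nonzero finitely generated module, and maps onto the residue
    field. *)
Lemma restriction_detect : ~ extends (ext_id A^o) a ->
  exists (chi : {linear dual K -> k}) (phi0 : dual K) (q : {linear A^o -> k}),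
    [/\ surj q, forall b, q b = 0 <-> nonunits b, chi phi0 = q 1
      & forall psi, chi (dual_map a psi) = 0].
Proof.
move=> next; have [q [sq kq]] := resk.
have [E [t [st kt]]] := submodule_quot (submodule_img (dual_map a)).
have [e0 ne0] : exists e0 : E, e0 <> 0.
  apply: contrapT => no; apply: next => f.
  have [|psi Epsi] := (kt (f : dual K)).1.
    by apply: contrapT => ?; apply: no; exists (t (f : dual K)).
  exists psi => x; have := congr1 (fun phi : dual K => dual_app phi x) Epsi.
  exact.
have [chi [e Ee]] := fg_to_residue noethA localA sq kq (fg_surj st fgK') ne0.
have [phi0 E0] := st e.
exists (chi \o t : {linear _ -> _}), phi0, q; split=> //=; first by rewrite E0.
by move=> psi; rewrite (kt _).2 ?linear0 //; exists psi.
Qed.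

(** In depth zero, the residue field embeds in the ring. The functional [chi]
    of [restriction_detect] becomes an element of the bidual of [K], that is, a
    nonzero element of [K] whose image in [G] is zero. *)
Lemma restriction_onto0 : ~ Ext_eq0 0 k A^o -> extends (ext_id A^o) a.
Proof.
move=> nhom; apply: contrapT => /restriction_detect.
move=> [chi [phi0 [q [sq kq Echi chi0]]]].
apply: nhom => f.
have [h _ hK] := refK; pose k0 := h ((f \o chi : {linear dual K -> A^o}) : dual (dual K)).
have Ek0 phi : dual_app phi k0 = f (chi phi).
  by rewrite -bidualE hK.
have k00 : k0 = 0.
  case: (sac) => ia _ _; apply: ia; rewrite linear0.
  apply: (reflexive_inj refG) => psi.
  by rewrite -dual_mapE Ek0 chi0 /dual_app !linear0.
have f1 : f (q 1) = 0 by rewrite -Echi -Ek0 k00 /dual_app linear0.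
move=> x; have [b <-] := sq x.
have -> : b = b *: (1 : A^o) by rewrite /GRing.scale /= mulr1.
by rewrite !linearZ /= f1 scaler0.
Qed.

(** The key step. Here [X] stands for a syzygy of the residue field, so
    [Ext^1(X, A)] plays the role of the first nonzero [Ext^d(k, A)], and it is
    killed by the maximal ideal. The class [eta] in it and the functional [chi]
    of [restriction_detect] combine into a map [S -> K] from a syzygy of [X].
    As a class in [Ext^1(X, K)] it dies in [Ext^1(X, G)], hence is zero,
    because maps [X -> N] lift to [G]; then so is [eta]. *)
Lemma restriction_onto1 X : fg_module X ->
    (forall b, nonunits b -> stably_kills b X) -> ~ Ext_eq0 1 X A^o ->
    (forall i, Ext_eq0 i.+1 (dual K) (dual X)) ->
    (forall i, Ext_eq0 i.+1 (dual G) (dual X)) ->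
    (forall f : {linear X -> N}, exists g : {linear X -> G}, forall x, c (g x) = f x) ->
  extends (ext_id A^o) a.
Proof.
move=> fgX killX next1 extKX extGX liftX.
apply: contrapT => /restriction_detect.
move=> [chi [phi0 [q [sq kq Echi chi0]]]].
have [S [F [j [e [fgS [fgF pF] sje]]]]] := fg_cover noethA fgX.
have [eta neta] : exists eta : {linear S -> A^o},
    ~ exists g : {linear F -> A^o}, forall x, g (j x) = eta x.
  apply: contrapT => no; apply: next1; apply/(ext1_shift _ pF sje) => f.
  by apply: contrapT => nf; apply: no; exists f.
(* T is the cokernel of dual F -> dual S, that is, Ext^1(X, A); the class of
   eta spans a copy of the residue field in it. *)
have [I [p [i [sp ii Ei]]]] := ses_image (dual_map j).
have [T [t sit]] := ses_coker ii.
have sXFI : ses (dual_map e) p.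
  case: (sje) => _ se ex; have [ie exe] := dual_left_exact se ex.
  by split=> //; exact: exact_corestrict ii Ei exe.
have im_t z : t z = 0 <-> exists g : dual F, dual_map j g = z.
  case: (sit) => _ _ ->; split=> [[y <-]|[g <-]].
    by have [g <-] := sp y; exists g; rewrite Ei.
  by exists (p g); rewrite Ei.
have [|theta Etheta] := factor_surj (f := Lin (scale_lin (t (eta : dual S)))) sq.
  move=> b /kq nb; rewrite /= /lin_fun -linearZ; apply/im_t.
  have [w Ew] := stably_kills_syzygy pF sje (killX b nb).
  exists (eta \o w : {linear _ -> _}); apply: dualP => x.
  by rewrite dual_mapE {1}/dual_app /= Ew linearZ.
have theta1 : theta (q 1) = t (eta : dual S).
  by rewrite Etheta /= /lin_fun scale1r.
have fdF : dominated (dual F) A^o.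
  by apply: fg_projective_dominated; exact: fg_projective_dual.
have [fgK _ _ extK'] := trK; have [fgG _ _ extG'] := trG.
(* The map theta o chi from dual K to T lifts to dual S; transposed, it is a
   map S -> K. *)
have [h Eh] : exists h : {linear dual K -> dual S},
    forall phi, t (h phi) = theta (chi phi).
  have [K1 [P1 [j1 [e1 [_ [_ pP1] sje1]]]]] := fg_cover noethA fgK'.
  have extI : Ext_eq0 1 (dual K) I.
    by apply: (ext_coker noethA sXFI) => //; exact: ext_dominated fdF (extK' 0%N).
  exact: (ext1_lift sit pP1 sje1 ((ext1_shift _ pP1 sje1).1 extI)
           (theta \o chi : {linear _ -> _})).
have [s' Es'] := reflexive_lift (swap h) refK.
have [g Eg] : exists g : {linear dual G -> dual F},
    forall psi, dual_map j (g psi) = h (dual_map a psi).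
  have fgG' : fg_module (dual G) by exact: fg_dual.
  have [K1 [P1 [j1 [e1 [_ [_ pP1] sje1]]]]] := fg_cover noethA fgG'.
  have [|hI EhI] := factor_ker (f := h \o dual_map a : {linear _ -> _}) sit.
    by move=> psi; rewrite /= Eh chi0 linear0.
  have [g Eg] := ext1_lift sXFI pP1 sje1 ((ext1_shift _ pP1 sje1).1 (extGX 0%N)) hI.
  by exists g => psi; rewrite -Ei Eg EhI.
have [g' Eg'] := reflexive_lift (swap g) refG.
have g'j x : g' (j x) = a (s' x).
  apply: (reflexive_inj refG) => psi.
  by rewrite Eg' swapE -dual_mapE Eg -[in RHS]dual_mapE Es' swapE.
(* The induced map X -> N lifts to G, so F -> G may be moved into K. *)
have [|f Ef] := factor_coker (f := c \o g' : {linear _ -> _}) sje.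
  by move=> x; rewrite /= g'j (ses0 _ sac).
have [f' Ef'] := liftX f.
have [|g3 Eg3] := factor_ker (f := g' \- (f' \o e) : {linear _ -> _}) sac.
  by move=> x; rewrite /= linearB Ef' Ef subrr.
have g3j x : g3 (j x) = s' x.
  case: (sac) => ia _ _; apply: ia.
  by rewrite Eg3 /= g'j (ses0 _ sje) linear0 subr0.
have /im_t [g4 Eg4] : t (eta : dual S) = 0.
  rewrite -theta1 -Echi -Eh; apply/im_t; exists (dual_map g3 phi0).
  by apply: dualP => x; rewrite !dual_mapE g3j Es' swapE.
apply: neta; exists g4 => x.
exact: (congr1 (fun phi : dual S => dual_app phi x) Eg4).
Qed.

(** Shifts [restriction_onto1] from degree one to degree [l + 1]. *)
Lemma restriction_onto l X : fg_module X ->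
    (forall b, nonunits b -> stably_kills b X) ->
    (forall i, (i < l)%N -> Ext_eq0 i.+1 X A^o) -> ~ Ext_eq0 l.+1 X A^o ->
    (forall i, Ext_eq0 i.+1 (dual K) (dual X)) ->
    (forall i, Ext_eq0 i.+1 (dual G) (dual X)) ->
    (if l is 0 then forall f : {linear X -> N}, exists g : {linear X -> G},
       forall x, c (g x) = f x
     else Ext_eq0 l X N) ->
  extends (ext_id A^o) a.
Proof.
elim: l X => [|l IHl] X fgX killX extX nextX extKX extGX extXN.
  exact: restriction_onto1 extXN.
have [S [F [j [e [fgS [fgF pF] sje]]]]] := fg_cover noethA fgX.
have extj := (ext1_shift _ pF sje).1 (extX 0%N isT).
have sdu := ses_dual sje extj.
have fdF : dominated (dual F) A^o.
  by apply: fg_projective_dominated; exact: fg_projective_dual.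
have [fgK _ _ extK'] := trK; have [fgG _ _ extG'] := trG.
apply: (IHl S) => //.
- move=> b nb; have [w Ew] := stably_kills_syzygy pF sje (killX b nb).
  by exists F, j, w.
- by move=> i il; apply/(ext_shift noethA _ _ pF fgS sje); exact: (extX i.+1 il).
- by move=> extS; apply: nextX; apply/(ext_shift noethA _ _ pF fgS sje).
- move=> i; apply: (ext_coker noethA sdu) => //.
  exact: ext_dominated fdF (extK' i).
- move=> i; apply: (ext_coker noethA sdu) => //; first exact: fg_dual.
  exact: ext_dominated fdF (extG' i).
case: l IHl extX nextX extXN => [|l] IHl extX nextX extXN; last first.
  by move/(ext_shift noethA _ _ pF fgS sje) in extXN.
move/(ext1_shift _ pF sje) in extXN => f.
have [f' Ef'] := extXN f; have [g Eg] := lift_ses f' pF sac.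
by exists (g \o j : {linear _ -> _}) => x; rewrite /= Eg Ef'.
Qed.

End Restriction.

Section DepthOfRing.
Variable d : nat.
Hypotheses (extA : forall l, (l < d)%N -> Ext_eq0 l k A^o) (nextA : ~ Ext_eq0 d k A^o).

Lemma ext_residue_ker K G N (a : {linear K -> G}) (c : {linear G -> N}) e :
    ses a c -> (forall l, (l < e.+1)%N -> Ext_eq0 l k G) ->
    (forall l, (l < e)%N -> Ext_eq0 l k N) ->
  forall l, (l < e.+1)%N -> Ext_eq0 l k K.
Proof.
move=> sac extG extN [|l] le.
  move=> f x; case: (sac) => ia _ _; apply: ia; rewrite linear0.
  exact: (extG 0%N le (a \o f : {linear _ -> _}) x).
apply: (ext_ker noethA sac) => //; last exact: extN.
by apply: Ext_eq0_map0; exact: extG.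
Qed.

(** By induction on the resolution: the kernel [K] is as deep as the ring by the
    depth lemma, functionals extend from it by [restriction_onto], and
    [totref_coker] concludes. *)
Lemma Gdim_lt_totref m N : Gdim_lt m N -> (forall l, (l < d)%N -> Ext_eq0 l k N) -> totref N.
Proof.
elim: m N => [|m IHm] N /=; first by move=> z0 _; exact: zero_totref.
move=> [K [G [a [c [trG sac /IHm trK]]]]] extN.
have {}trK : totref K.
  apply: trK => l ld; case: (d) ld extN (ext_residue_totref trG extA) => // d' ld extN extG.
  by apply: (ext_residue_ker sac extG) ld => l' l'd; apply: extN; exact: ltnW.
apply: (totref_coker noethA sac trK trG).
case: d extA nextA extN => [|d'] extA' nextA' extN.
  exact: restriction_onto0 sac trK trG nextA'.
have dk0 : zero_module (dual k) by apply: dual_residue_zero; exact: extA'.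
apply: (restriction_onto sac trK trG (l := d') fgk) => //.
- by move=> b nb; apply: annihilated_stably_kills => x; exact: residue_kill.
- by move=> i id'; exact: extA'.
- move=> i; apply: ext_zero_r => //.
  by case: trK => fgK _ _ _; exact: fg_dual.
- move=> i; apply: ext_zero_r => //.
  by case: trG => fgG _ _ _; exact: fg_dual.
case: d' extA' nextA' extN => [|d'] extA' nextA' extN; last exact: extN.
move=> f; exists (\0 : {linear _ -> _}) => x.
by rewrite /= linear0 [f x](extN 0%N).
Qed.

(** Passing from [N] to [K] raises the depth by one as long as it is below [d];
    after [j] steps [Gdim_lt_totref] applies. *)
Lemma Gdim_lt_ext_aux j m N : Gdim_lt m N ->
  (forall l, (l + j < d)%N -> Ext_eq0 l k N) -> forall i, (j <= i)%N -> Ext_eq0 i.+1 N A^o.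
Proof.
elim: j m N => [|j IHj] m N Gm extN i ji.
  have [_ _ + _] : totref N; last exact.
  by apply: Gdim_lt_totref Gm _ => l ld; apply: extN; rewrite addn0.
case: m Gm => [z0|m [K [G [a [c [trG sac Gm]]]]]]; first exact: ext_zero.
case: i ji => // i ji; have [fgG _ extG _] := trG.
apply: (ext_right noethA sac) => //; apply: IHj Gm _ i ji => l ld.
apply: (ext_residue_ker sac _ _ (ltnSn l)) => l' l'l.
  apply: ext_residue_totref trG extA _ _.
  exact: (leq_ltn_trans (l'l : (l' <= l)%N) (leq_ltn_trans (leq_addr j l) ld)).
by apply: extN; rewrite addnS -addSn; apply: leq_ltn_trans ld; rewrite leq_add2r.
Qed.

(** The Auslander--Bridger inequality in terms of Ext: a finite Gorenstein
    dimension is at most the depth [d] of the ring. *)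
Lemma Gdim_lt_ext m N : Gdim_lt m N -> forall i, (d <= i)%N -> Ext_eq0 i.+1 N A^o.
Proof.
by move=> Gm; apply: Gdim_lt_ext_aux Gm _ => l; rewrite ltnNge leq_addl.
Qed.

End DepthOfRing.
End AuslanderBridger.


(** * Localization *)

Section Localization.
Variables (R : comPzRingType) (p : spec R).
Implicit Types (M N K L P Q : lmodType R) (s t u : den p).
Local Notation A := (loc_ring p).

(** A fraction of ring elements, typed as an element of the ring [R_p] and not of
    the module [loc p R]. *)
Definition fr (r : R) s : A := frac (r : R^o) s.

Lemma frP (a : A) : exists r s, a = fr r s.
Proof. exact: loc_ringP. Qed.

Lemma fr_scale M r s (m : M) t : fr r s *: frac m t = frac (r *: m) (denM s t).
Proof. exact: loc_scaleE. Qed.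

Lemma fr_mul r s r' t : fr r s * fr r' t = fr (r * r') (denM s t).
Proof. exact: (@loc_scaleE _ p R^o r s r' t). Qed.

Lemma frac0E M (m : M) s : frac m s = 0 <-> exists u, den_val u *: m = 0.
Proof.
rewrite [X in _ = X](_ : _ = frac 0 (den1 p)) //; split.
  by move=> /eq_frac [u]; rewrite scale1r !scaler0 => E; exists u.
by move=> [u E]; apply/eq_frac; exists u; rewrite scale1r !scaler0.
Qed.

Lemma frac_eq1 M (m n : M) s : frac m s = frac n s <-> exists u, den_val u *: m = den_val u *: n.
Proof.
split=> [/eq_frac [u E]|[u E]].
  by exists (denM u s); rewrite -!scalerA.
by apply/eq_frac; exists u; rewrite !scalerA !(mulrC (den_val u)) -!scalerA E.
Qed.

Lemma frac_cancel M (m : M) s t : frac (den_val t *: m) (denM t s) = frac m s.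
Proof.
apply/eq_frac; exists (den1 p) => /=.
by rewrite !scalerA; congr (_ *: _); ring.
Qed.

Lemma fracD M (m n : M) s : frac (m + n) s = frac m s + frac n s.
Proof. by rewrite frac_add -scalerDr frac_cancel. Qed.

Lemma frac0 M s : frac (0 : M) s = 0.
Proof. by apply/frac0E; exists s; rewrite scaler0. Qed.

Lemma fracZ M r (m : M) s : frac (r *: m) s = fr r s *: frac m (den1 p).
Proof.
rewrite fr_scale; apply/eq_frac; exists (den1 p) => /=.
by rewrite mulr1.
Qed.

Lemma frac_comb M n (c : 'I_n -> R) (g : 'I_n -> M) s :
  frac (\sum_i c i *: g i) s = \sum_i fr (c i) s *: frac (g i) (den1 p).
Proof.
rewrite (big_morph (fun m => frac m s) (fun m n => fracD m n s) (frac0 M s)).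
by apply: eq_bigr => i _; rewrite fracZ.
Qed.

Lemma fr_comb n (c : 'I_n -> R) (g : 'I_n -> R) s :
  fr (\sum_i c i * g i) s = \sum_i fr (c i) s * fr (g i) (den1 p).
Proof. exact: (@frac_comb R^o). Qed.

Definition loc_map_fun M N (f : {linear M -> N}) (x : loc p M) : loc p N :=
  frac (f (loc_num x)) (loc_den x).

Lemma loc_map_funE M N (f : {linear M -> N}) m s :
  loc_map_fun f (frac m s) = frac (f m) s.
Proof.
have [u E] := loc_repr m s; apply/eq_frac; exists u.
by rewrite -!(linearZ_LR f) E.
Qed.

Lemma loc_map_linear M N (f : {linear M -> N}) : linear (loc_map_fun f : loc p M -> loc p N).
Proof.
move=> a x y; case: (fracP x) => m [s ->]; case: (fracP y) => n [t ->].
case: (frP a) => r [v ->].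
rewrite (loc_map_funE f m s) (loc_map_funE f n t) ![_ *: frac _ _]fr_scale.
by rewrite (frac_add (r *: m)) (frac_add (r *: f m)) loc_map_funE linearD !(linearZ_LR f).
Qed.

Definition loc_map M N (f : {linear M -> N}) : {linear loc p M -> loc p N} :=
  Lin (loc_map_linear f).

Lemma loc_mapE M N (f : {linear M -> N}) m s : loc_map f (frac m s) = frac (f m) s.
Proof. exact: loc_map_funE. Qed.

Lemma loc_surj M N (f : {linear M -> N}) : surj f -> surj (loc_map f).
Proof.
move=> sf y; case: (fracP y) => n [s ->]; have [m <-] := sf n.
by exists (frac m s); rewrite loc_mapE.
Qed.

Lemma loc_ses K M N (j : {linear K -> M}) (e : {linear M -> N}) :
  ses j e -> ses (loc_map j) (loc_map e).
Proof.
move=> [ij se ex]; split; last 1 first.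
- move=> y; case: (fracP y) => m [s ->]; rewrite loc_mapE frac0E.
  split=> [[u Eu]|[x]].
    have [|x Ex] := (ex (den_val u *: m)).1; first by rewrite linearZ.
    by exists (frac x (denM u s)); rewrite loc_mapE Ex frac_cancel.
  case: (fracP x) => z [t ->]; rewrite loc_mapE => /eq_frac [u Eu].
  exists (denM u t); rewrite /= -scalerA -!(linearZ_LR e) -Eu !(linearZ_LR e).
  by rewrite (ex (j z)).2 ?scaler0 //; exists z.
- apply: inj_linear => x; case: (fracP x) => z [t ->].
  rewrite loc_mapE !frac0E => -[u Eu]; exists u.
  by apply: ij; rewrite (linearZ_LR j) Eu linear0.
- exact: loc_surj.
Qed.

(** The localization of the module [R] is the ring [R_p], viewed as a module
    over itself. *)
Definition loc_reg : {linear loc p R^o -> A^o} :=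
  Lin ((fun a x y => erefl) : linear (fun x : loc p R^o => x : A^o)).

Lemma loc_reg_frac (r : R) s : loc_reg (frac (r : R^o) s) = fr r s.
Proof. by []. Qed.

Lemma loc_fg_projective P : fg_projective P -> fg_projective (loc p P).
Proof.
move=> /fg_projectiveP [n [r [s rs]]]; apply/fg_projectiveP.
have cl i : linear (fun v : 'rV[R]_n => v 0 i : R^o).
  by move=> a x y; rewrite !mxE.
have sl : linear (fun x : loc p 'rV[R]_n =>
    \row_i (loc_reg (loc_map (Lin (cl i)) x) : A)).
  by move=> a x y; apply/rowP => i; rewrite !mxE !linearP.
exists n, (loc_map r \o comb (fun i => frac (delta_mx 0 i) (den1 p)) : {linear _ -> _}),
  (Lin sl \o loc_map s : {linear _ -> _}) => x.
case: (fracP x) => m [t ->] /=; rewrite loc_mapE.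
have -> : lin_fun sl (frac (s m) t) = \row_i fr (s m 0 i) t.
  by apply/rowP => i; rewrite !mxE loc_mapE.
rewrite -[m in RHS]rs -[RHS]loc_mapE; congr (loc_map r _).
rewrite [in RHS](row_sum_delta (s m)) frac_comb /lin_fun.
by apply: eq_bigr => i _; rewrite mxE.
Qed.

Lemma loc_fg M : fg_module M -> fg_module (loc p M).
Proof.
move=> /fgP [n [f sf]]; apply: fg_surj (loc_surj sf) _.
by case: (loc_fg_projective (fg_projective_rV R n)).
Qed.

Lemma loc_noetherian : noetherian R -> noetherian A.
Proof.
move=> noethR J [J0 JD JM].
have [|n [g Eg]] := noethR [set r | J (fr r (den1 p))].
  split=> /=; first by rewrite /fr frac0.
    by move=> x y Jx Jy; rewrite /fr fracD; exact: JD.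
  move=> a x Jx; rewrite (_ : fr _ _ = fr a (den1 p) * fr x (den1 p)); first exact: JM.
  by rewrite fr_mul /fr; apply/eq_frac; exists (den1 p); rewrite /= mulr1.
exists n, (fun i => fr (g i) (den1 p)); apply/seteqP; split=> x /=; last first.
  move=> [c ->]; elim/big_ind: _ => // i _; apply: JM.
  suff : [set r | J (fr r (den1 p))] (g i) by [].
  rewrite Eg /=; exists (fun l => (l == i)%:R).
  rewrite (bigD1 i) //= big1 ?addr0 ?eqxx ?mul1r // => l /negbTE ->.
  by rewrite mul0r.
case: (frP x) => r [s ->] Jx.
have : [set r | J (fr r (den1 p))] r.
  rewrite /= (_ : fr _ _ = fr (den_val s) (den1 p) * fr r s); first exact: JM.
  rewrite fr_mul /fr; apply/eq_frac; exists (den1 p) => /=.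
  by rewrite !regular_scale; ring.
rewrite Eg => -[c Ec]; exists (fun i => fr (c i) s).
by rewrite -fr_comb -Ec.
Qed.

Lemma loc_nonunit r s : nonunits (fr r s) <-> p r.
Proof.
case: (specP p) => -[p0 pD pM] p1 prp; split=> [nu|pr [y]].
  apply: contrapT => pr; apply: nu; exists (fr (den_val s) (Den pr)).
  rewrite fr_mul; apply/eq_frac; exists (den1 p) => /=.
  by rewrite !regular_scale; ring.
case: (frP y) => q [t ->].
rewrite fr_mul => /eq_frac [u /=].
rewrite !regular_scale => E; apply: (@denP _ _ (denM u (denM t s))) => /=.
have -> : den_val u * (den_val t * den_val s) = den_val u * (1 * (q * r)).
  by rewrite E; ring.
by do 3!apply: (pM _ _); exact: pr.
Qed.

Lemma loc_local : ideal (@nonunits A).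
Proof.
case: (specP p) => -[p0 pD pM] p1 prp; split.
- suff : nonunits (fr 0 (den1 p)) by rewrite /fr frac0.
  exact/loc_nonunit.
- move=> x y; case: (frP x) => r [s ->]; case: (frP y) => q [t ->].
  move=> /(loc_nonunit r s) pr /(loc_nonunit q t) pq.
  rewrite (_ : _ + _ = fr (den_val t * r + den_val s * q) (denM s t)); last exact: loc_ring_add.
  by apply/loc_nonunit; apply: pD; exact: pM.
- move=> x y; case: (frP x) => r [s ->]; case: (frP y) => q [t ->].
  move=> /(loc_nonunit q t) pq.
  rewrite (_ : _ * _ = fr (r * q) (denM s t)); last exact: fr_mul.
  by apply/loc_nonunit; exact: pM.
Qed.

(** ** Clearing denominators *)

Lemma den_prod n (s : 'I_n -> den p) : ~ p (\prod_i den_val (s i)).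
Proof.
by move=> /(prime_prod (specP p)) [i]; exact: denP.
Qed.

Lemma common_denominator n (y : 'I_n -> A) :
  exists t (a : 'I_n -> R), forall i, fr (den_val t) (den1 p) * y i = fr (a i) (den1 p).
Proof.
have /choice [a Ea] : forall i, exists rs : R * den p, y i = fr rs.1 rs.2.
  by move=> i; case: (frP (y i)) => r [s ->]; exists (r, s).
exists (Den (@den_prod _ (fun i => (a i).2))).
exists (fun i => (a i).1 * \prod_(j | j != i) den_val (a j).2) => i.
rewrite Ea fr_mul /= (bigD1 i) //=; apply/eq_frac; exists (den1 p) => /=.
by rewrite !regular_scale; ring.
Qed.

(** The values of [g] on a dual basis of [L] have a common denominator. *)
Lemma clear_functional L (g : {linear loc p L -> A^o}) : fg_projective L ->
  exists t (w : {linear L -> R^o}), forall x,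
    fr (den_val t) (den1 p) * g (frac x (den1 p)) = fr (w x) (den1 p).
Proof.
move=> /dual_basis [n [b [eps E]]].
have [t [a Ea]] := common_denominator (fun i => g (frac (b i) (den1 p)) : A).
have wl : linear (fun x : L => \sum_i dual_app (eps i) x * a i : R^o).
  move=> c x y; rewrite scaler_sumr -big_split; apply: eq_bigr => i _ /=.
  rewrite dual_app_linear mulrDl; congr (_ + _).
  by rewrite /GRing.scale /= mulrA.
exists t, (Lin wl) => x; rewrite [in LHS](E x) frac_comb linear_sum mulr_sumr.
rewrite /= /lin_fun fr_comb; apply: eq_bigr => i _.
by rewrite linearZ [LHS]mulrCA Ea.
Qed.

Lemma clear_zero L (z : {linear L -> R^o}) : fg_module L ->
    (forall x, exists u, den_val u *: z x = 0) ->
  exists u, forall x, den_val u *: z x = 0.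
Proof.
move=> [n [g Eg]] zx; have /choice [u Eu] := fun i => zx (g i).
exists (Den (@den_prod _ u)) => x; have [c ->] := Eg x.
rewrite linear_sum scaler_sumr big1 // => i _.
rewrite linearZ /= (bigD1 i) //= !regular_scale.
have := Eu i; rewrite regular_scale => Ei.
by rewrite mulrCA -mulrA [X in _ * X]mulrCA Ei !mulr0.
Qed.

(** If [Ext^1(N, R)] vanishes at [p], a functional on [L1] that dies on the
    kernel of [delta] comes from [L0], up to a denominator: this holds over
    [R_p], and denominators can be cleared on finitely many generators. *)
Lemma ext1_local L1 L0 N (delta : {linear L1 -> L0}) (e : {linear L0 -> N})
    (z : {linear L1 -> R^o}) :
    fg_module L1 -> fg_projective L0 -> surj e -> exact_at delta e ->
    Ext_eq0 1 (loc p N) A^o -> (forall x, delta x = 0 -> z x = 0) ->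
  exists u (w : {linear L0 -> R^o}), forall x, den_val u *: z x = w (delta x).
Proof.
move=> fgL1 fpL0 se ex ext zk.
have [I [q [i [sie sq Ei]]]] := exact_image se ex; have [ii _ _] := sie.
have [|f Ef] := factor_surj (f := z) sq.
  by move=> x qx; apply: zk; rewrite -Ei qx linear0.
have [g Eg] := ext1_extends ext (loc_ses sie) (loc_reg \o loc_map f : {linear _ -> _}).
have [t [w Ew]] := clear_functional g fpL0.
have [x|u Eu] := @clear_zero L1
  ((den_val t \*: z) \- (w \o delta) : {linear L1 -> R^o}) fgL1.
  have : fr (den_val t * z x) (den1 p) = fr (w (delta x)) (den1 p).
    rewrite -Ew -Ei -[frac _ _](loc_mapE i) Eg /= loc_mapE loc_reg_frac Ef fr_mul.
    by rewrite /fr; apply/eq_frac; exists (den1 p); rewrite /= mulr1.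
  move=> /frac_eq1 [v Ev]; exists v.
  by rewrite /= scalerBr [_ *: (_ *: _)]Ev subrr.
exists (denM u t), (den_val u \*: w) => x /=; apply/eqP.
rewrite -subr_eq0 -scalerA -scalerBr; apply/eqP; exact: Eu.
Qed.

End Localization.


(** * The transpose *)

Section Transpose.
Variable R : comPzRingType.
Hypothesis noethR : noetherian R.
Implicit Types (M N K L P Q T D Y : lmodType R).

Lemma transpose_fg N D : transpose N D -> fg_module N /\ fg_module D.
Proof.
move=> [P1 [P0 [phi [e [q [[fp1 fp0] [se _] [sq _]]]]]]]; split.
  by apply: fg_surj se _; case: fp0.
by apply: fg_surj sq _; case: (fg_projective_dual fp1).
Qed.

Lemma transpose_exists M : fg_module M -> exists T, transpose M T.
Proof.
move=> fgM; have [K [P0 [j [e [fgK fp0 sje]]]]] := fg_cover noethR fgM.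
have [K1 [P1 [j1 [e1 [_ fp1 sje1]]]]] := fg_cover noethR fgK.
pose phi : {linear P1 -> P0} := j \o e1.
have [T [q [sq kq]]] := submodule_quot (submodule_img (dual_map phi)).
exists T, P1, P0, phi, e, q; split=> //; split=> //; first by case: sje.
case: sje => _ _ ex; case: sje1 => _ s1 _ y; rewrite ex.
split=> [[x <-]|[x <-]]; first by have [z <-] := s1 x; exists z.
by exists (e1 x).
Qed.

(** Finitely generated projective modules being reflexive, dualising the
    presentation of the transpose gives back the original one. *)
Lemma transpose_sym M T : transpose M T -> transpose T M.
Proof.
move=> [P1 [P0 [phi [e [q [[fp1 fp0] [se ex] [sq exq]]]]]]].
have r1 := fg_projective_reflexive fp1; have r0 := fg_projective_reflexive fp0.
have [b0 Eb0] := reflexive_lift (ext_id (dual (dual P0))) r0.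
have b0K x : b0 (bidual x) = x.
  by apply: (reflexive_inj r0) => f; rewrite Eb0.
have Kb0 th : bidual (b0 th) = th by apply: dualP => f; rewrite bidualE Eb0.
exists (dual P0), (dual P1), (dual_map phi), q, (e \o b0 : {linear _ -> _}).
split; [by split; exact: fg_projective_dual|by []|split].
  by move=> y; have [x <-] := se y; exists (bidual x); rewrite /= b0K.
move=> th; rewrite /= ex; split=> [[x Ex]|[xi <-]].
  exists (bidual x); rewrite -(Kb0 th) -Ex.
  by apply: dualP => f.
have [x <-] : exists x, bidual x = xi by case: r1 => g _ gK; exists (g xi).
exists x; apply: (reflexive_inj r0) => f.
by rewrite Eb0.
Qed.

(** The kernel of the map from [D] to the dual of the next projective in a
    resolution of [N] is [Ext^1(N, R)]. When it is zero the cokernel is, by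
    construction, a transpose of the syzygy of [N]. *)
Lemma transpose_step N D : transpose N D -> Ext_eq0 1 N R^o ->
  exists (I P : lmodType R) (i : {linear I -> P}) (e : {linear P -> N})
         (L D' : lmodType R) (a : {linear D -> L}) (c : {linear L -> D'}),
    [/\ ses i e, fg_projective P, ses a c, fg_projective L & transpose I D'].
Proof.
move=> [P1 [P0 [phi [e [q [[fp1 fp0] [se ex] [sq exq]]]]]]] ext.
have [I [p [i [sie sp Ei]]]] := exact_image se ex; have [ii _ _] := sie.
have [K [j sjp]] := ses_ker sp.
have fgP1 : fg_module P1 by case: fp1.
have [_ [P2 [_ [e2 [_ fp2 [_ s2 _]]]]]] := fg_cover noethR (ses_fg noethR sjp fgP1).1.
pose psi : {linear P2 -> P1} := j \o e2.
have exp : exact_at psi p.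
  case: sjp => _ _ exj y; rewrite exj.
  split=> [[x <-]|[x <-]]; first by have [z <-] := s2 x; exists z.
  by exists (e2 x).
have [D' [c [sc kc]]] := submodule_quot (submodule_img (dual_map psi)).
have [|a Ea] := factor_surj (f := dual_map psi) sq.
  move=> z /exq [w <-]; apply: dualP => x; rewrite !dual_mapE -Ei.
  by rewrite (exp _).2 ?linear0 /dual_app ?linear0 //; exists x.
exists I, P0, i, e, (dual P2), D', a, c; split=> //.
- split=> // [|y].
    apply: inj_linear => y; have [z <-] := sq y; rewrite Ea => z0.
    have [|f Ef] := factor_surj (f := z) sp.
      move=> x /exp [w <-].
      exact: (congr1 (fun u : dual P2 => dual_app u w) z0).
    have [g Eg] := ext1_extends ext sie f.
    apply/exq; exists (g : dual P0); apply: dualP => x.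
    by rewrite dual_mapE -Ei {1}/dual_app [g _]Eg /= Ef.
  rewrite kc /=; split=> [[z <-]|[z <-]]; first by exists (q z).
  by have [w <-] := sq z; exists w.
- exact: fg_projective_dual.
by exists P2, P1, psi, p, c.
Qed.

(** The associated primes of [Ext^1(N, R)] are associated to [D], because
    [Ext^1(N, R)] is the kernel of the map from [D] to the dual of the next
    projective in a resolution of [N]; the submodule [S] below is this kernel. *)
Lemma ext1_local_global N D : transpose N D ->
    (forall p : spec R, (exists m : D, ann m = p) ->
       Ext_eq0 1 (loc p N) (loc_ring p)^o) ->
  Ext_eq0 1 N R^o.
Proof.
move=> [P1 [P0 [phi [e [q [[fp1 fp0] [se ex] [sq exq]]]]]]] extp.
pose S : set D := [set y | exists z : dual P1,
  (forall x, phi x = 0 -> dual_app z x = 0) /\ q z = y].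
have subS : submodule S.
  split=> [|c _ _ [z [kz <-]] [w [kw <-]]]; first by exists 0; rewrite linear0.
  exists (c *: z + w); rewrite linearP; split=> // x phx.
  by rewrite dual_appD dual_appZ kz // kw // mulr0 addr0.
have [E [inc [iinc Einc]]] := submodule_incl subS.
have S0 y : S y -> y = 0.
  move=> /Einc [y0 <-]; apply: contrapT => ny.
  have [|m [maxm _]] := @max_ann_exists R noethR E y0.
    by move=> E0; apply: ny; rewrite E0 linear0.
  pose p := Spec (max_ann_prime maxm).
  have annp : ann (inc m) = p.
    apply/seteqP; split=> r; rewrite /ann /= -linearZ_LR => rm.
      by apply: iinc; rewrite rm linear0.
    by rewrite rm linear0.
  have [z [kz qz]] : S (inc m) by apply/Einc; exists m.
  have fgP1 : fg_module P1 by case: fp1.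
  have [|u [w Ew]] := ext1_local (p := p) (z := z) fgP1 fp0 se ex _ kz.
    by apply: extp; exists (inc m).
  apply: (denP (d := u)) => //; rewrite -annp /ann /= -qz -linearZ_LR.
  apply/exq; exists (w : dual P0); apply: dualP => x.
  exact/esym/Ew.
have [I [p [i [sie sp Ei]]]] := exact_image se ex; have [ii _ _] := sie.
exists I, P0, i, e; split=> //; first by case: fp0.
move=> f; have /S0 /exq [g Eg] : S (q ((f \o p : {linear P1 -> R^o}) : dual P1)).
  exists ((f \o p : {linear P1 -> R^o}) : dual P1); split=> // x phx.
  rewrite /dual_app /=; have -> : p x = 0 by apply: ii; rewrite Ei phx linear0.
  exact: linear0.
exists g => x; have [y <-] := sp x; rewrite Ei.
exact: (congr1 (fun u : dual P1 => dual_app u y) Eg).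
Qed.

(** * Syzygies *)

(** The syzygy condition, one embedding at a time. *)
Fixpoint syz (k : nat) M : Prop :=
  match k with
  | 0 => True
  | k'.+1 => exists (Q Y : lmodType R) (a : {linear M -> Q}) (c : {linear Q -> Y}),
      [/\ fg_projective Q, ses a c & syz k' Y]
  end.

Lemma syzygy_syz k M : syzygy k M -> syz k M.
Proof.
case: k => [//|k] [//|[Q [d [e [fpQ ie ex0 ex]]]]].
elim: k M Q d e fpQ ie ex0 ex => [|k IHk] M Q d e fpQ ie ex0 ex;
  have [Y [c sec]] := ses_coker ie; exists (Q 0%N), Y, e, c; split=> //;
  try exact: fpQ.
case: (sec) => _ sc exc.
have [|e' Ee'] := factor_coker (f := d 0%N) sec.
  by move=> x; apply/(ex0 isT); exists x.
apply: (IHk Y (fun j => Q j.+1) (fun j => d j.+1) e').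
- by move=> j jk; exact: fpQ.
- apply: inj_linear => y; have [x <-] := sc y; rewrite Ee' => /(ex0 isT) [z <-].
  exact: ses0.
- move=> k0 y; rewrite (ex 0%N) //; split=> [[x <-]|[x <-]].
    by exists (c x).
  by have [z <-] := sc x; exists z.
- by move=> j jk; exact: ex.
Qed.

Lemma syz_syzygy k M : syz k M -> syzygy k M.
Proof.
elim: k M => [|k IHk] M; first by left.
move=> [Q [Y [a [c [fpQ sac /IHk sY]]]]]; case: (sac) => ia sc exa; right.
case: k IHk sY => [|k] IHk sY.
  exists (fun=> Q), (fun=> \0 : {linear Q -> Q}), a; split=> //.
case: sY => // -[QY [dY [eY [fpQY ieY exY0 exY]]]].
pose Q' j : lmodType R := if j is j'.+1 then QY j' else Q.
pose d' j : {linear Q' j -> Q' j.+1} :=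
  match j with 0 => eY \o c | j'.+1 => dY j' end.
have im0 y : (exists x, d' 0%N x = y) <-> exists z, eY z = y.
  split=> [[x <-]|[z <-]]; first by exists (c x).
  by have [x <-] := sc z; exists x.
exists Q', d', a; split=> //.
- by case=> [|j] jk; [exact: fpQ|exact: fpQY].
- move=> _ y; rewrite -exa /=; split=> [E|->]; last exact: linear0.
  by apply: ieY; rewrite E linear0.
- case=> [|j] jk y; last exact: exY.
  by rewrite im0; exact: exY0.
Qed.

Lemma ext_syz k N D : transpose N D ->
  (forall i, (i < k)%N -> Ext_eq0 i.+1 N R^o) -> syz k D.
Proof.
elim: k N D => [//|k IHk] N D tr ext.
have [I [P [i [e [L [D' [a [c [sie [fgP pP] sac fpL tr']]]]]]]]] :=
  transpose_step tr (ext 0%N isT).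
exists L, D', a, c; split=> //; apply: IHk tr' _ => l lk.
apply/(ext_shift noethR _ _ pP _ sie); last exact: (ext l.+1 lk).
by case: (ses_fg noethR sie fgP).
Qed.

(** * The condition on depths *)

Definition res_field (p : spec R) : lmodType (loc_ring p) :=
  sval (cid (residue_exists (loc_local p))).

Lemma res_fieldP p : residue (res_field p).
Proof. exact: (svalP (cid (residue_exists (loc_local p)))). Qed.

(** The depth of [R_p] is at most [t]. *)
Definition shallow (p : spec R) (t : nat) : Prop :=
  exists2 d, (d <= t)%N & ~ Ext_eq0 d (res_field p) (loc_ring p)^o.

Lemma deep_ext p t d : ~ shallow p t -> (d <= t)%N ->
  Ext_eq0 d (res_field p) (loc_ring p)^o.
Proof. by move=> nsh dt; apply: contrapT => next; apply: nsh; exists d. Qed.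

Let noethp p : noetherian (loc_ring p) := @loc_noetherian R p noethR.

Lemma depth_loc_geP p M n : fg_module M -> ((n%:Z)%:E <= depth (loc p M))%E <->
  forall l, (l < n)%N -> Ext_eq0 l (res_field p) (loc p M).
Proof.
by move=> fgM; exact: (depth_geP (@noethp p) (loc_local p) (res_fieldP p) n (loc_fg p fgM)).
Qed.

Lemma depth_ring_geP p n : ((n%:Z)%:E <= depth (loc_ring p)^o)%E <->
  forall l, (l < n)%N -> Ext_eq0 l (res_field p) (loc_ring p)^o.
Proof.
exact: (depth_geP (@noethp p) (loc_local p) (res_fieldP p) n (@fg_regular _)).
Qed.

Lemma StildeP k M : fg_module M -> Stilde k M <->
  forall p l, (l < k)%N -> ~ shallow p l -> Ext_eq0 l (res_field p) (loc p M).
Proof.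
move=> fgM; split=> [St p l lk deep|ext p].
  apply: (depth_loc_geP p l.+1 fgM).1 (ltnSn l).
  apply: le_trans (St p); rewrite le_min; apply/andP; split.
    by rewrite lee_fin lez_nat.
  by apply/depth_ring_geP => d dl; exact: deep_ext deep _.
have [n [-> nk nd]] : exists n, [/\ Order.min (k%:Z)%:E (depth (loc_ring p)^o) = (n%:Z)%:E,
    (n <= k)%N & ((n%:Z)%:E <= depth (loc_ring p)^o)%E].
  have [[N ->]|->] := depth_value (@noethp p) (loc_local p) (res_fieldP p) (@fg_regular (loc_ring p)).
    exists (minn k N); split; rewrite ?geq_minl ?lee_fin ?lez_nat ?geq_minr //.
    rewrite -EFin_min; congr (_%:E).
    by case: (leqP k N) => kN; [apply/min_idPl|apply/min_idPr]; rewrite lez_nat // ltnW.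
  by exists k; split.
apply/(depth_loc_geP p n fgM) => l ln; apply: ext; first exact: leq_trans ln nk.
move=> [d dl]; apply; apply: (depth_ring_geP p n).1 => //.
exact: leq_ltn_trans dl ln.
Qed.

Lemma shallow_Xtilde p k l : (l < k)%N -> shallow p l -> Xtilde (k%:Z - 1) p.
Proof.
move=> lk [d dl next]; rewrite /Xtilde /=.
have nd : ~ ((d.+1%:Z)%:E <= depth (loc_ring p)^o)%E.
  by move=> /depth_ring_geP /(_ d (ltnSn d)).
have [[N EN]|EN] := depth_value (@noethp p) (loc_local p) (res_fieldP p) (@fg_regular (loc_ring p)).
  rewrite EN in nd *; rewrite lee_fin; case: k lk => // k lk.
  rewrite -addn1 PoszD addrK lez_nat.
  rewrite lee_fin lez_nat in nd; rewrite leqNgt; apply/negP => kN; apply: nd.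
  exact: (leq_ltn_trans dl (leq_ltn_trans (lk : (l <= k)%N) kN)).
by case: nd; rewrite EN; exact: leey.
Qed.

(** The depth lemma, iterated along a syzygy sequence. *)
Lemma syz_ext k M p l : syz k M -> (l < k)%N -> ~ shallow p l ->
  Ext_eq0 l (res_field p) (loc p M).
Proof.
elim: k M l => [//|k IHk] M l [Q [Y [a [c [fpQ sac syzY]]]]] lk deep.
have extQ d : (d <= l)%N -> Ext_eq0 d (res_field p) (loc p Q).
  move=> dl; apply: ext_dominated (deep_ext deep dl).
  by apply: fg_projective_dominated; exact: loc_fg_projective.
have sacp := loc_ses p sac.
case: l lk deep extQ => [|l] lk deep extQ.
  move=> f x; case: (sacp) => ia _ _; apply: ia; rewrite linear0.
  exact: (extQ 0%N isT (loc_map p a \o f : {linear _ -> _}) x).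
apply: (ext_ker (@noethp p) sacp); first exact: (fg_residue (res_fieldP p)).
  by apply: Ext_eq0_map0; exact: extQ.
apply: IHk => // -[d dl next]; apply: deep; exists d => //.
exact: leqW.
Qed.

(** At an associated prime [p] of [D] there is a map from the residue field to
    [D_p], so [p] is shallow by the first hypothesis and the second applies. *)
Lemma ext1_transpose_eq0 k j N D : transpose N D ->
    (forall p, (j < k)%N -> ~ shallow p j -> Ext_eq0 0 (res_field p) (loc p D)) ->
    (forall p, (j < k)%N -> shallow p j -> Ext_eq0 1 (loc p N) (loc_ring p)^o) ->
  (j < k)%N -> Ext_eq0 1 N R^o.
Proof.
move=> tr HD HN jk; apply: ext1_local_global tr _ => p [m annm].
have [sh|deep] := pselect (shallow p j); first exact: HN sh.
have /(hom_residue (loc_local p) (res_fieldP p)) := HD p jk deep.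
move=> /(_ (frac m (den1 p))) m0; exfalso.
have /frac0E [u um] : frac m (den1 p) = 0 :> loc p D.
  apply: m0 => a; have [r [s ->]] := frP a => /loc_nonunit pr.
  have -> : fr r s *: frac m (den1 p) = frac (r *: m) (denM s (den1 p)) by exact: fr_scale.
  have -> : r *: m = 0; last exact: frac0.
  by have : ann m r by rewrite annm.
by apply: (@denP _ _ u); rewrite -annm.
Qed.

(** Here [N] is a [j]-th syzygy of the transpose of the module under study and
    [D] the matching cokernel; both the depth of [D_p] and the bound on the
    degrees of [Ext(N_p, R_p)] have moved by [j], whence the shifts. *)
Lemma ext_transpose_eq0 k i j N D : transpose N D ->
    (forall p l, (l + j < k)%N -> ~ shallow p (l + j) -> Ext_eq0 l (res_field p) (loc p D)) ->
    (forall p l, (l + j < k)%N -> shallow p (l + j) ->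
       Ext_eq0 l.+1 (loc p N) (loc_ring p)^o) ->
  (i + j < k)%N -> Ext_eq0 i.+1 N R^o.
Proof.
elim: i j N D => [|i IHi] j N D tr HD HN ijk.
  by apply: (@ext1_transpose_eq0 k j N D) => // p; [exact: (HD p 0%N)|exact: (HN p 0%N)].
have jk : (j < k)%N by apply: leq_ltn_trans ijk; exact: leq_addl.
have ext1 : Ext_eq0 1 N R^o.
  by apply: (@ext1_transpose_eq0 k j N D) => // p; [exact: (HD p 0%N)|exact: (HN p 0%N)].
have [I [P [ii [e [L [D' [a [c [sie [fgP pP] sac fpL tr']]]]]]]]] := transpose_step tr ext1.
have fgI := (ses_fg noethR sie fgP).1.
apply/(ext_shift noethR _ _ pP fgI sie).
apply: (IHi j.+1 I D') => // [p l|p l|]; rewrite ?addnS -?addSn //.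
  move=> lk deep; apply: (ext_coker (@noethp p) (loc_ses p sac)).
  - exact: (fg_residue (res_fieldP p)).
  - apply: ext_dominated (deep_ext deep _); last exact: leqW (leq_addr _ _).
    by apply: fg_projective_dominated; exact: loc_fg_projective.
  - exact: (HD p l.+1).
move=> lk sh; have [_ pPp] := loc_fg_projective p (conj fgP pP).
apply/(ext_shift (@noethp p) _ _ pPp (loc_fg p fgI) (loc_ses p sie)).
exact: (HN p l.+1).
Qed.

End Transpose.

(** * Gorenstein dimension *)

Section Gorenstein.
Variable R : comPzRingType.
Implicit Types (M N K G : lmodType R).

Lemma totally_reflexive_totref G : totally_reflexive G -> totref G.
Proof.
by move=> [fgG refG ext ext']; split=> // i; apply: Ext_vanishes_eq0; [exact: ext|exact: ext'].
Qed.

Lemma G_resolution_Gdim_lt m N : G_resolution_of_length m N -> Gdim_lt m.+1 N.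
Proof.
move=> [C [d [e [res trC zC]]]].
elim: m N C d e res trC zC => [|m IHm] N C d e [se ex0 ex] trC zC;
  have [K [j sje]] := ses_ker se; exists K, (C 0%N), j, e;
  (split=> //; first exact/totally_reflexive_totref/trC);
  have [|q Eq] := factor_ker (f := d 0%N) sje;
  try (by move=> x; apply/ex0; exists x);
  case: (sje) => ij _ _;
  have sq : surj q by [move=> y; have [x Ex] := (ex0 (j y)).1 (ses0 y sje);
                       exists x; apply: ij; rewrite Eq|].
  by move=> y; have [x <-] := sq y; rewrite (zC 1%N isT x) linear0.
apply: (IHm K (fun i => C i.+1) (fun i => d i.+1) q).
- split=> // y; rewrite -(ex 0%N y); split=> [qy|dy].
    by rewrite -Eq qy linear0.
  by apply: ij; rewrite Eq dy linear0.
- by move=> i im; exact: trC.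
- by move=> i im; exact: zC.
Qed.

Lemma Gdim_finite N : (Gdim N < +oo)%E -> exists m, Gdim_lt m N.
Proof.
rewrite /Gdim => fin.
have [[m /G_resolution_Gdim_lt Gm]|no] := pselect (exists m, G_resolution_of_length m N).
  by exists m.+1.
have E : [set (m%:Z)%:E | m in [set m | G_resolution_of_length m N]] = set0 :> set (\bar int).
  by apply/seteqP; split=> // x [m Gm _]; apply: no; exists m.
by move: fin; rewrite E /infimum eqxx ltxx.
Qed.

End Gorenstein.

Section Equivalences.
Variable R : comPzRingType.
Hypothesis noethR : noetherian R.
Implicit Types (M T : lmodType R).

(** The dual of [M] is a second syzygy of the transpose. *)
Lemma transpose_Gdim_lt p m M T : fg_module M -> transpose M T ->
  Gdim_lt m (loc p (dual M)) -> Gdim_lt m.+2 (loc p T).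
Proof.
move=> fgM [P1 [P0 [phi [e [q [[fp1 fp0] [se ex] [sq exq]]]]]]] Gm.
have [I [r [i [siq sr Ei]]]] := exact_image sq exq; have [ii _ _] := siq.
have ser : ses (dual_map e) r.
  have [ie exe] := dual_left_exact se ex.
  by split=> //; exact: exact_corestrict ii Ei exe.
have totP P : fg_projective P -> totref (loc p (dual P)).
  move=> fP; apply: totref_projective; apply: loc_fg_projective.
  exact: fg_projective_dual.
exists (loc p I), (loc p (dual P1)), (loc_map p i), (loc_map p q).
split; [exact: totP|exact: loc_ses|].
exists (loc p (dual M)), (loc p (dual P0)), (loc_map p (dual_map e)), (loc_map p r).
by split; [exact: totP|exact: loc_ses|].
Qed.

Lemma Gdim_shallow_ext p l M T : fg_module M -> transpose M T ->
    (Gdim (loc p (dual M)) < +oo)%E -> shallow p l ->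
  Ext_eq0 l.+1 (loc p T) (loc_ring p)^o.
Proof.
move=> fgM tr /Gdim_finite [m /(transpose_Gdim_lt fgM tr) Gm] [d0 d0l next0].
have exn : exists d, `[< ~ Ext_eq0 d (res_field p) (loc_ring p)^o >].
  by exists d0; exact/asboolP.
case: (ex_minnP exn) => d /asboolP next mind.
apply: (Gdim_lt_ext (@loc_noetherian R p noethR) (loc_local p) (res_fieldP p) _ next Gm).
  move=> l' l'd; apply: contrapT => nl'; move: l'd; rewrite ltnNge => /negP; apply.
  by apply: mind; exact/asboolP.
by apply: leq_trans d0l; apply: mind; exact/asboolP.
Qed.

Lemma torsionfree_syz k M : torsionfree k M -> syz k M.
Proof.
move=> [T [tr ext]]; apply: (ext_syz noethR (transpose_sym tr)) => i ik.
by apply: Ext_vanishes_eq0; exact: ext.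
Qed.

Lemma syz_Stilde k M : fg_module M -> syz k M -> Stilde k M.
Proof.
by move=> fgM syzM; apply/(StildeP noethR) => // p l; exact: syz_ext.
Qed.

(** Starting point of [ext_transpose_eq0]: [j = 0], [N = T] and [D = M]. *)
Lemma Stilde_torsionfree k M : fg_module M ->
    (forall p : spec R, Xtilde (k%:Z - 1) p -> (Gdim (loc p (dual M)) < +oo)%E) ->
  Stilde k M -> torsionfree k M.
Proof.
move=> fgM GdimM /(StildeP noethR _ fgM) St.
have [T tr] := transpose_exists noethR fgM; exists T; split=> // -[//|i] /andP [_ ik].
have [_ fgT] := transpose_fg tr.
apply: (Ext_eq0_vanishes noethR) => //.
apply: (@ext_transpose_eq0 _ noethR k i 0 T M (transpose_sym tr)); rewrite ?addn0 //.
  by move=> p l; rewrite addn0; exact: St.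
move=> p l; rewrite addn0 => lk sh; apply: (Gdim_shallow_ext fgM tr _ sh).
by apply: GdimM; exact: (shallow_Xtilde noethR lk sh).
Qed.

End Equivalences.

Theorem theorem1p1 (R : comPzRingType) (k : nat) (M : lmodType R)
    (noethR : noetherian R) (fgM : fg_module M)
    (GdimM : forall p : spec R, Xtilde (k%:Z - 1) p ->
       (Gdim (loc p (dual M)) < +oo)%E) :
  (torsionfree k M <-> syzygy k M) /\ (syzygy k M <-> Stilde k M).
Proof.
have tf_sy : torsionfree k M -> syzygy k M.
  by move=> /(torsionfree_syz noethR) /syz_syzygy.
have sy_St : syzygy k M -> Stilde k M.
  by move=> /syzygy_syz; exact: syz_Stilde.
have St_tf : Stilde k M -> torsionfree k M by exact: Stilde_torsionfree.
by split; split=> // H; [exact/St_tf/sy_St|exact/tf_sy/St_tf].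
Qed.
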